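(* Let $G,H,K$ be metric spaces with $K$ nonempty and compact, let $i_G:K\hookrightarrow G$ and $i_H:K\hookrightarrow H$ be isometric embeddings, and let $X=G\cup_K H$ be the gluing. Assume that every $y\in H\setminus i_H(K)$ projects to $K=i_H(K)$. Then for every $\ell\ge 0$ there is a homotopy equivalence $$\mathcal{M}^\ell(X)\simeq\mathring{\mathcal{M}}^\ell(H)\vee\mathcal{M}^\ell(G).$$
   Context: Gluing. $X=G\cup_K H$ is $G\sqcup H$ with $i_G(k)$ and $i_H(k)$ identified for all $k\in K$, with the metric $d_X=d_G$ on $G$, $d_X=d_H$ on $H$, and $d_X(x,y)=\min_{k\in K}(d_G(x,i_G(k))+d_H(i_H(k),y))$ for $x\in G$, $y\in H$. We regard $K\subset G,H,X$ and write $\mathrm{int}(H)=H\setminus K$. A point $y\in H$ projects to $K$ if there exists $\pi(y)\in K$ with $d_H(k,y)=d_H(k,\pi(y))+d_H(\pi(y),y)$ for every $k\in K$. For points $x_0,\dots,x_n$ of a metric space write $d(x_0,\dots,x_n)=\sum_{i=1}^n d(x_{i-1},x_i)$. The causal order on $X\times\mathbb{R}$ is $(x,t)\le(x',t')$ iff $d(x,x')\le t'-t$. $\mathrm{Cau}^\ell(X;a,b)=\{(x,t)\in X\times[0,\ell]\mid d(a,x)\le t,\ d(x,b)\le\ell-t\}$, and $\mathrm{Cau}^\ell(X)=\bigsqcup_{a,b\in X}\mathrm{Cau}^\ell(X;a,b)$ (disjoint union of posets). $\Delta P$ is the order complex of a poset $P$ (simplices are finite nonempty chains). $\Delta'\mathrm{Cau}^\ell(X)$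 is the subcomplex of $\Delta\mathrm{Cau}^\ell(X)$ of chains $(x_0,t_0)<\dots<(x_n,t_n)$ with $d(x_0,\dots,x_n)<\ell$. The total magnitude homotopy type is the pointed CW complex $\mathcal{M}^\ell(X)=|\Delta\mathrm{Cau}^\ell(X)|/|\Delta'\mathrm{Cau}^\ell(X)|$ (with $Y/\emptyset=Y\sqcup\{*\}$, $\emptyset/\emptyset=\{*\}$). $S'(H)$ is the set of simplices $((x_0,t_0),\dots,(x_n,t_n))\in\Delta\mathrm{Cau}^\ell(H)$ such that $x_k\in\mathrm{int}(H)$ for some $k$. The union $S'(H)\cup\Delta'\mathrm{Cau}^\ell(H)$ is a subcomplex of $\Delta\mathrm{Cau}^\ell(H)$, and $$\mathring{\mathcal{M}}^\ell(H)=\frac{|S'(H)\cup\Delta'\mathrm{Cau}^\ell(H)|}{|\Delta'\mathrm{Cau}^\ell(H)|}.$$ *)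

(* Defs.v *)
From HB Require Import structures.
From mathcomp Require Import all_boot all_order all_algebra finmap generic_quotient.
From mathcomp Require Import all_classical all_reals topology normedtype derive.
From mathcomp Require Import homotopy lra.

Set Implicit Arguments.
Unset Strict Implicit.
Unset Printing Implicit Defensive.

Import Order.TTheory GRing.Theory Num.Theory.
Import numFieldNormedType.Exports.

Local Open Scope classical_set_scope.
Local Open Scope ring_scope.
Local Open Scope quotient_scope.

Definition isometric (R : realType) (X Y : metricType R) (f : X -> Y) : Prop :=
  forall x y, mdist (f x) (f y) = mdist x y.

Definition projects_to (R : realType) (X : metricType R) (A : set X) (y : X)
    : Prop :=
  exists2 p, A p & forall k, A k -> mdist k y = mdist k p + mdist p y.

Lemma isometric_inj (R : realType) (X Y : metricType R) (f : X -> Y) :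
  isometric f -> injective f.
Proof.
move=> isof x y fxy; apply: mdist_positivity; rewrite -isof fxy.
exact: mdistxx.
Qed.

Section gluing.
Context (R : realType) (K G H : metricType R) (iG : K -> G) (iH : K -> H).

(* For compact nonempty K this infimum is a minimum: see [glue_cross_min]. *)
Definition glue_cross (g : G) (h : H) : R :=
  inf [set mdist g (iG k) + mdist (iH k) h | k in [set: K]].

Definition glue_dist (u v : G + H) : R :=
  match u, v with
  | inl g, inl g' => mdist g g'
  | inr h, inr h' => mdist h h'
  | inl g, inr h | inr h, inl g => glue_cross g h
  end.

Definition glue_rel (u v : G + H) : bool :=
  match u, v with
  | inl g, inl g' => g == g'
  | inr h, inr h' => h == h'
  | inl g, inr h | inr h, inl g => `[< exists k, g = iG k /\ h = iH k >]
  end.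

Section equiv.
Hypotheses (isoG : isometric iG) (isoH : isometric iH).

Lemma glue_rel_refl : reflexive glue_rel.
Proof. by case=> x /=. Qed.

Lemma glue_rel_sym : symmetric glue_rel.
Proof. by case=> x [] y //=; rewrite eq_sym. Qed.

Lemma glue_rel_trans : transitive glue_rel.
Proof.
have injG := isometric_inj isoG; have injH := isometric_inj isoH.
case=> y [] x [] z //=.
- by move=> /eqP -> /eqP ->.
- by move=> /eqP ->.
- by move=> xy /eqP <-.
- move=> /asboolP[k [yk xk]] /asboolP[k' [yk' zk']].
  by rewrite xk zk' (injG k k') // -yk -yk'.
- move=> /asboolP[k [xk yk]] /asboolP[k' [zk' yk']].
  by rewrite xk zk' (injH k k') // -yk -yk'.
- by move=> xy /eqP <-.
- by move=> /eqP ->.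
- by move=> /eqP -> /eqP ->.
Qed.

Definition glue_equiv := EquivRel glue_rel glue_rel_refl glue_rel_sym
  glue_rel_trans.

End equiv.

Section metric.
Hypotheses (K0 : [set: K] !=set0) (cK : compact [set: K]).
Hypotheses (isoG : isometric iG) (isoH : isometric iH).

Lemma glue_cross_cts (g : G) (h : H) :
  continuous (fun k : K => mdist g (iG k) + mdist (iH k) h : R).
Proof.
move=> k; apply/cvgrPdist_lt => e e0.
have : nbhs k (ball k (e / 2)) by apply: nbhsx_ballx; rewrite divr_gt0.
apply: filterS => k' /=; rewrite ballEmdist /= => kk'.
have tG := metric_triangle g (iG k) (iG k').
have tG' := metric_triangle g (iG k') (iG k).
have tH := metric_triangle (iH k) (iH k') h.
have tH' := metric_triangle (iH k') (iH k) h.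
rewrite isoG in tG; rewrite isoG (metric_sym k') in tG'.
rewrite isoH in tH; rewrite isoH (metric_sym k') in tH'.
rewrite ltr_norml; apply/andP; split; lra.
Qed.

Lemma glue_cross_min (g : G) (h : H) : exists k,
  glue_cross g h = mdist g (iG k) + mdist (iH k) h /\
  forall k', glue_cross g h <= mdist g (iG k') + mdist (iH k') h.
Proof.
have [k _ kmin] := compact_EVT_min K0 cK
  (continuous_subspaceT (@glue_cross_cts g h)).
have lb : lbound [set mdist g (iG k) + mdist (iH k) h | k in [set: K]]
    (mdist g (iG k) + mdist (iH k) h).
  by move=> _ [k' _ <-]; apply: kmin; rewrite inE.
suff E : glue_cross g h = mdist g (iG k) + mdist (iH k) h.
  by exists k; split=> // k'; rewrite E; apply: kmin; rewrite inE.
apply/eqP; rewrite eq_le; apply/andP; split.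
  by apply: ge_inf; [exists (mdist g (iG k) + mdist (iH k) h)|exists k].
by apply: lb_le_inf => //; exists (mdist g (iG k) + mdist (iH k) h), k.
Qed.

Lemma glue_dist_refl u : glue_dist u u = 0.
Proof. by case: u => x /=; rewrite mdistxx. Qed.

Lemma glue_dist_sym u v : glue_dist u v = glue_dist v u.
Proof. by case: u v => x [] y //=; rewrite metric_sym. Qed.

Lemma glue_dist_triangle v u w :
  glue_dist u w <= glue_dist u v + glue_dist v w.
Proof.
case: u v w => x [] y [] z /=; try exact: metric_triangle.
- have [k [-> _]] := glue_cross_min y z.
  have [_ [_ /(_ k)]] := glue_cross_min x z.
  by have := metric_triangle x y (iG k); lra.
- have [k [-> _]] := glue_cross_min x y.
  have [k' [-> _]] := glue_cross_min z y.
  have := metric_triangle x (iG k) z.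
  have := metric_triangle (iG k) (iG k') z.
  have := metric_triangle (iH k) y (iH k').
  rewrite isoG isoH (metric_sym (iG k') z) (metric_sym (iH k') y); lra.
- have [k [-> _]] := glue_cross_min x y.
  have [_ [_ /(_ k)]] := glue_cross_min x z.
  by have := metric_triangle (iH k) y z; lra.
- have [k [-> _]] := glue_cross_min y x.
  have [_ [_ /(_ k)]] := glue_cross_min z x.
  have := metric_triangle z y (iG k).
  by rewrite (metric_sym z y); lra.
- have [k [-> _]] := glue_cross_min y x.
  have [k' [-> _]] := glue_cross_min y z.
  have := metric_triangle x (iH k) z.
  have := metric_triangle (iH k) (iH k') z.
  have := metric_triangle (iG k) y (iG k').
  rewrite isoG isoH (metric_sym (iG k) y) (metric_sym x (iH k)); lra.
- have [k [-> _]] := glue_cross_min z y.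
  have [_ [_ /(_ k)]] := glue_cross_min z x.
  have := metric_triangle (iH k) y x.
  by rewrite (metric_sym x y); lra.
Qed.

Lemma glue_dist_eq0 u v : glue_dist u v = 0 <-> glue_rel u v.
Proof.
have cross g h : glue_cross g h = 0 <-> exists k, g = iG k /\ h = iH k.
  split=> [|[k [-> ->]]]; last first.
    have [k1 [E /(_ k)]] := glue_cross_min (iG k) (iH k).
    rewrite !mdistxx addr0 {}E => le0; apply/eqP.
    by rewrite eq_le le0 addr_ge0 ?mdist_ge0.
  have [k [-> _]] := glue_cross_min g h => /eqP.
  rewrite paddr_eq0 ?mdist_ge0 // => /andP[/eqP/mdist_positivity gk].
  by move=> /eqP/mdist_positivity hk; exists k.
case: u v => x [] y /=.
- by split=> [/mdist_positivity ->//|/eqP ->]; rewrite mdistxx.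
- by rewrite cross; split=> /asboolP.
- by rewrite cross; split=> /asboolP.
- by split=> [/mdist_positivity ->//|/eqP ->]; rewrite mdistxx.
Qed.

(* The gluing of G and H along K, with its metric. The hypotheses on K, iG and
   iH are parameters of the type because they are what makes the relation an
   equivalence and the function a distance. *)
Definition gluing : Type :=
  (fun (_ : [set: K] !=set0) (_ : compact [set: K]) =>
    {eq_quot glue_equiv isoG isoH}) K0 cK.

HB.instance Definition _ := Quotient.copy gluing {eq_quot glue_equiv isoG isoH}.
HB.instance Definition _ := Choice.copy gluing {eq_quot glue_equiv isoG isoH}.

Definition gluing_dist (x y : gluing) : R := glue_dist (repr x) (repr y).

Lemma gluing_distE u v :
  gluing_dist (\pi_gluing u) (\pi_gluing v) = glue_dist u v.
Proof.
have E w : glue_dist (repr (\pi_gluing w)) w = 0.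
  apply/glue_dist_eq0.
  by apply/(@eqquotP _ (glue_equiv isoG isoH) {eq_quot glue_equiv isoG isoH});
    rewrite reprK.
rewrite /gluing_dist.
have Eu := E u; have Ev := E v.
move: Eu Ev; set u' := repr _; set v' := repr _ => Eu Ev.
have := glue_dist_triangle u u' v'; have := glue_dist_triangle v u v'.
have := glue_dist_triangle u' u v; have := glue_dist_triangle v' u' v.
rewrite (glue_dist_sym u u') (glue_dist_sym v v') Eu Ev => *.
by apply/eqP; rewrite eq_le; apply/andP; split; lra.
Qed.

Lemma gluing_dist_refl x : gluing_dist x x = 0.
Proof. exact: glue_dist_refl. Qed.

Lemma gluing_dist_positivity x y : gluing_dist x y = 0 -> x = y.
Proof.
move=> /glue_dist_eq0 xy; rewrite -[x]reprK -[y]reprK.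
by apply/(@eqquotP _ (glue_equiv isoG isoH) {eq_quot glue_equiv isoG isoH}).
Qed.

Lemma gluing_dist_sym x y : gluing_dist x y = gluing_dist y x.
Proof. exact: glue_dist_sym. Qed.

Lemma gluing_dist_triangle y x z :
  gluing_dist x z <= gluing_dist x y + gluing_dist y z.
Proof. exact: glue_dist_triangle. Qed.

HB.instance Definition _ := @isMetric.Build R gluing gluing_dist
  gluing_dist_refl gluing_dist_positivity gluing_dist_sym gluing_dist_triangle.

Lemma gluing_mdistE u v :
  mdist (\pi_gluing u) (\pi_gluing v) = glue_dist u v.
Proof. exact: gluing_distE. Qed.

End metric.
End gluing.

Section simplicial_complexes.
Context (R : realType) (V : choiceType).
Implicit Types (s : {fset V}) (K L : set {fset V}).

Definition closed_simplex s : set (V -> R) :=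
  [set t | [/\ forall v, 0 <= t v, forall v, v \notin s -> t v = 0 &
               \sum_(v <- s) t v = 1]].

(* Points are given by their barycentric coordinates. *)
Definition realization K : Type :=
  set_type [set t : V -> R | exists2 s, K s & closed_simplex s t].

HB.instance Definition _ K := Choice.on (realization K).

(* The weak topology: a set is open when its trace on each closed simplex is
   open. On a closed simplex the product topology of V -> R is the Euclidean
   topology since all but finitely many coordinates vanish. *)
Definition realization_open K (U : set (realization K)) : Prop :=
  forall s, K s -> exists2 O : set (prod_topology (fun _ : V => R)), open O &
    forall x : realization K, closed_simplex s (val x) -> (U x <-> O (val x)).

Lemma realization_openT K : @realization_open K setT.
Proof. by move=> s Ks; exists setT => //; exact: openT. Qed.

Lemma realization_openI K : setI_closed (@realization_open K).
Proof.
move=> A B oA oB s Ks; have [OA oOA AE] := oA s Ks.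
have [OB oOB BE] := oB s Ks; exists (OA `&` OB); first exact: openI.
by move=> x sx; rewrite /setI /= AE // BE.
Qed.

Lemma realization_open_bigU K (I : Type) (f : I -> set (realization K)) :
  (forall i, realization_open (f i)) -> realization_open (\bigcup_i f i).
Proof.
move=> of_ s Ks.
have /choice[O OP] : forall i, exists O : set (prod_topology (fun _ : V => R)),
    open O /\ forall x : realization K, closed_simplex s (val x) ->
      (f i x <-> O (val x)).
  by move=> i; have [O oO OE] := of_ i s Ks; exists O.
exists (\bigcup_i O i); first by apply: bigcup_open => i _; have [] := OP i.
move=> x sx; split=> -[i _ fix_]; exists i => //; have [_ /(_ _ sx)] := OP i.
  by move=> <-.
by move=> ->.
Qed.

HB.instance Definition _ K := @isOpenTopological.Build (realization K)
  (@realization_open K) (@realization_openT K) (@realization_openI K)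
  (@realization_open_bigU K).

Definition subrealization K L : set (realization K) :=
  [set x | exists2 s, L s & closed_simplex s (val x)].

End simplicial_complexes.

Section quotient_space.
Context (Y : topologicalType) (A : set Y).

(* Y/A: the points of Y outside A, together with the base point None, which is
   the class of A. *)
Definition collapse : Type := option (set_type (~` A)).

HB.instance Definition _ := Choice.on collapse.
HB.instance Definition _ := isPointed.Build collapse None.

Definition collapse_map : Y -> collapse := insub.

(* The final topology along the projection. When A is empty the base point is
   outside the image of the projection, hence isolated: Y/set0 is the disjoint
   union of Y and a point. *)
Definition collapse_open (U : set collapse) : Prop :=
  open (collapse_map @^-1` U).

Lemma collapse_openT : collapse_open setT.
Proof. exact: openT. Qed.

Lemma collapse_openI : setI_closed collapse_open.
Proof. by move=> U W oU oW; exact: openI. Qed.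

Lemma collapse_open_bigU (I : Type) (f : I -> set collapse) :
  (forall i, collapse_open (f i)) -> collapse_open (\bigcup_i f i).
Proof. by move=> of_; apply: bigcup_open => i _; exact: of_. Qed.

HB.instance Definition _ := @isOpenTopological.Build collapse
  collapse_open collapse_openT collapse_openI collapse_open_bigU.

End quotient_space.

Section homotopy_equivalence.
Context (R : realType).

(* Homotopies and homotopy equivalences preserve the base points. *)
Definition pointed_homotopic (X Y : ptopologicalType) (f g : X -> Y) : Prop :=
  exists h : R * X -> Y,
    [/\ {within `[0, 1]%classic `*` [set: X], continuous h},
        forall x, h (0, x) = f x, forall x, h (1, x) = g x &
        forall t, 0 <= t <= 1 -> h (t, point) = point].

Definition pointed_homotopy_equivalent (X Y : ptopologicalType) : Prop :=
  exists (f : X -> Y) (g : Y -> X),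
    [/\ continuous f, continuous g, f point = point & g point = point] /\
    pointed_homotopic (g \o f) id /\ pointed_homotopic (f \o g) id.

End homotopy_equivalence.

Definition wedge2 (X Y : ptopologicalType) : ptopologicalType :=
  pwedge (fun b : bool => if b then X else Y).

Section order_complex.
Context (d : Order.disp_t) (P : porderType d).

(* A chain is listed in strictly increasing order. *)
Definition chain (s : seq P) : bool := (s != [::]) && sorted <%O s.

Definition order_complex : set {fset P} :=
  [set [fset x in s]%fset | s in [set s | chain s]].

End order_complex.

Arguments order_complex {d} P.

Section causal_order.
Context (R : realType) (X : metricType R).

Definition causal : Type := (X * R)%type.

HB.instance Definition _ := Choice.on causal.

Definition causal_le (p q : causal) : bool := mdist p.1 q.1 <= q.2 - p.2.

Lemma causal_le_refl : reflexive causal_le.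
Proof. by move=> p; rewrite /causal_le mdistxx subrr. Qed.

Lemma causal_le_anti : antisymmetric causal_le.
Proof.
move=> [x t] [y u]; rewrite /causal_le /= => /andP[xy yx].
have := mdist_ge0 x y; have := mdist_ge0 y x => yx0 xy0.
have tu : t = u by apply/eqP; rewrite eq_le; apply/andP; split; lra.
rewrite tu; congr (_, _); apply: mdist_positivity; apply/eqP.
by rewrite eq_le xy0 andbT; move: xy; rewrite tu subrr.
Qed.

Lemma causal_le_trans : transitive causal_le.
Proof.
move=> [y u] [x t] [z w]; rewrite /causal_le /= => xy yz.
by have := metric_triangle x y z; lra.
Qed.

Fact causal_display : Order.disp_t. Proof. exact: Order.Disp tt tt. Qed.

HB.instance Definition _ := Order.Le_isPOrder.Build causal_display causal
  causal_le_refl causal_le_anti causal_le_trans.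

End causal_order.

Section Cau.
Context (R : realType) (l : R) (X : metricType R).

Definition Cau_between (a b : X) : set (causal X) :=
  [set p | [/\ 0 <= p.2 <= l, mdist a p.1 <= p.2 & mdist p.1 b <= l - p.2]].

Definition Cau : Type := {ab : X * X & Cau_between ab.1 ab.2}.

HB.instance Definition _ := Choice.on Cau.

Definition Cau_event (u : Cau) : causal X := val (tagged u).

Definition Cau_point (u : Cau) : X := (Cau_event u).1.

Definition Cau_le (u v : Cau) : bool :=
  (tag u == tag v) && (Cau_event u <= Cau_event v)%O.

Lemma Cau_le_refl : reflexive Cau_le.
Proof. by move=> u; rewrite /Cau_le eqxx lexx. Qed.

Lemma Cau_le_anti : antisymmetric Cau_le.
Proof.
move=> [a p] [b q] /andP[/andP[/= /eqP ab pq] /andP[_ qp]].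
subst b; congr existT; apply: val_inj; apply: le_anti.
by apply/andP.
Qed.

Lemma Cau_le_trans : transitive Cau_le.
Proof.
move=> v u w /andP[/eqP uv luv] /andP[/eqP vw lvw].
by rewrite /Cau_le uv vw eqxx (le_trans luv lvw).
Qed.

HB.instance Definition _ := Order.Le_isPOrder.Build causal_display Cau
  Cau_le_refl Cau_le_anti Cau_le_trans.

Definition path_length (s : seq X) : R :=
  if s is x :: s' then \sum_(r <- pairmap mdist x s') r else 0.

(* [order_complex Cau] is the complex Delta Cau; the next two sets are
   Delta' Cau, and S' for a subspace A whose complement is the interior. *)
Definition short_complex : set {fset Cau} :=
  [set [fset u in s]%fset | s in
    [set s : seq Cau | chain s /\ path_length (map Cau_point s) < l]].

Definition interior_simplices (A : set X) : set {fset Cau} :=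
  [set [fset u in s]%fset | s in
    [set s : seq Cau | chain s /\ exists2 u, u \in s & ~ A (Cau_point u)]].

Definition magnitude_type : ptopologicalType :=
  @collapse (realization R (order_complex Cau))
    (subrealization short_complex).

Definition interior_magnitude_type (A : set X) : ptopologicalType :=
  @collapse (realization R (interior_simplices A `|` short_complex))
    (subrealization short_complex).

End Cau.

(* Main.v *)
(* A vertex (x, t) of Cau(X) is outer when x lies in G \ K or in H \ K, and a
   chain is mixed when it has outer vertices of both kinds. In a mixed chain
   choose consecutive outer vertices of different kinds, say one over G \ K and
   one (h, t) over H \ K. Since d(g, h) = d(g, pi(h)) + d(pi(h), h) for all g in
   G, the vertex (pi(h), t -+ d(pi(h), h)) can be inserted between them without
   changing the length of the chain. Moving the mass of the outer vertices, all
   at unit speed, to the inserted vertex for as long as the support is mixed is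
   a continuous deformation of |Delta Cau(X)| which preserves |Delta' Cau(X)|
   and ends in the unmixed chains; until it stops, an outer vertex of mass x_v
   has mass max(0, x_v - t) at time t, whence the formula [push]. An
   unmixed chain of length l lies in G, or lies in H and has an interior vertex;
   in the latter case its faces without interior vertex are short, because
   d(k, h) + d(h, k') > d(k, k') for h in H \ K. So the quotient of the
   unmixed chains is the wedge. *)

Require Import Defs.
From HB Require Import structures.
From mathcomp Require Import all_boot all_order all_algebra finmap.
From mathcomp Require Import all_classical all_reals topology normedtype.
From mathcomp Require Import homotopy lra.

Set Implicit Arguments.
Unset Strict Implicit.
Unset Printing Implicit Defensive.

Import Order.TTheory GRing.Theory Num.Theory.
Import numFieldNormedType.Exports.

Local Open Scope classical_set_scope.
Local Open Scope ring_scope.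

(** * Topology of realizations and quotients *)

(** The vertices [p M] chosen for different outer sets [M] are not related to each other, and no
    compatibility with faces is available. Two facts replace it: [p M] depends on [M] alone, and the
    outer supports met by a moving point are superlevel sets of its initial coordinates, hence
    nested. The time spent with outer support [M] is then a difference between a minimum and a
    maximum of coordinates, cut off at 0. So the position at any time is a finite sum, from which
    continuity, independence of the simplex and conservation of mass can be read off. Time 1
    suffices because no barycentric coordinate exceeds 1.

    A second obstacle lies in the end points [a], [b] of [Cau(X; a, b)]: a chain with all its
    vertices over [G] may have end points elsewhere, and then it does not come from [Cau(G)]. A
    chain of length [l] starts at [a] and ends at [b], so this happens only for short chains, which
    the quotient collapses.

    One composite of the two maps is the identity on the nose; the other is the deformation at time
    1. *)

Section final_topology.

(* The tube lemma: compact intervals of times make the final topology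
   compatible with the product. *)
Lemma final_prod_continuous (R : realType) (Q Z : topologicalType) (I : Type)
    (T : I -> topologicalType) (phi : forall i, T i -> Q) (h : R * Q -> Z) :
  (forall U : set Q, (forall i, open (@phi i @^-1` U)) -> open U) ->
  (forall i, continuous (fun p : R * T i => h (p.1, phi i p.2))) ->
  (forall q, continuous (fun t : R => h (t, q))) -> continuous h.
Proof.
move=> finQ hT hq [t0 q0] W; rewrite nbhsE => -[W' [oW' W'h] W'W].
have : nbhs t0 [set t | W' (h (t, q0))].
  by apply: (hq q0); apply: open_nbhs_nbhs; split.
move=> /nbhs_ballP[e /= e0 eW'].
pose J := `[t0 - e / 2, t0 + e / 2]%classic.
pose U := [set q | forall t, J t -> W' (h (t, q))].
have oU : open U.
  apply: finQ => i; rewrite openE => x /= Ux.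
  have /compact_near_coveringP nc :=
    @segment_compact R (t0 - e / 2) (t0 + e / 2).
  apply: (nc _ (nbhs x) (fun y t => W' (h (t, phi i y))) (nbhs_filter x)).
  move=> t Jt; have := hT i (t, x) W'.
  rewrite /nbhs /=; apply.
  by apply: open_nbhs_nbhs; split => //; exact: Ux.
exists ([set t | J t], U).
  split => /=; last first.
    apply: open_nbhs_nbhs; split => // t.
    rewrite /J /= in_itv /= => /andP[t1 t2]; apply: eW'.
    by rewrite /ball /= ltr_norml; apply/andP; split; lra.
  apply/nbhs_ballP; exists (e / 2) => /=; first by rewrite divr_gt0.
  move=> t; rewrite /ball /= /J /= in_itv /= ltr_norml => /andP[t1 t2].
  by apply/andP; split; lra.
by move=> [t q] /= [Jt Uq]; apply: W'W; exact: Uq.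
Qed.

Lemma prod_topology_continuous (S : topologicalType) (I : Type)
    (K : I -> topologicalType) (f : S -> prod_topology K) :
  (forall i, continuous (fun x => f x i)) -> continuous f.
Proof.
move=> fc x; apply/cvg_sup => i.
move: x; apply/(@continuousP _ (initial_topology (@^~ i))) => A [B oB <-].
by have /continuousP := fc i; exact.
Qed.

End final_topology.

Section realization.
Context (R : realType) (V : choiceType).
Implicit Types (s : {fset V}) (K : set {fset V}).

Local Notation coordinates := (prod_topology (fun _ : V => R)).

Lemma coordinate_continuous (v : V) :
  continuous (fun x : coordinates => x v).
Proof. by move=> x; exact: (@proj_continuous _ (fun _ : V => R) v x). Qed.

Lemma closed_closed_simplex s : closed (closed_simplex s : set coordinates).
Proof.
have closedT (f : coordinates -> R) (D : set R) :
    continuous f -> closed D -> closed (f @^-1` D).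
  by move=> fc; apply: closed_comp => x _; exact: fc.
rewrite [X in closed X](_ : _ =
    (\bigcap_v (fun t : coordinates => t v) @^-1` [set r | 0 <= r]) `&`
    (\bigcap_(v in [set v | v \notin s])
      (fun t : coordinates => t v) @^-1` [set r | r = 0]) `&`
    (fun t : coordinates => \sum_(v <- s) t v) @^-1` [set r | r = 1]); last first.
  apply/seteqP; split => t.
    move=> [t0 ts t1]; split => //; split => v; last exact: ts.
    by move=> _; exact: t0.
  by move=> [[t0 ts] t1]; split => // v; exact: t0.
apply: closedI; first apply: closedI.
- by apply: closed_bigI => v _; apply: closedT;
    [exact: coordinate_continuous|exact: closed_ge].
- by apply: closed_bigI => v _; apply: closedT;
    [exact: coordinate_continuous|exact: closed_eq].
- apply: closedT; last exact: closed_eq.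
  apply: continuous_big; first exact: add_continuous.
  by move=> v _; exact: coordinate_continuous.
Qed.

Definition simplex s : Type := set_type (closed_simplex s : set coordinates).

HB.instance Definition _ s := Topological.copy (simplex s)
  (set_type (closed_simplex s : set coordinates)).

Lemma simplexP s (x : simplex s) : closed_simplex s (val x).
Proof. exact: set_valP x. Qed.

Lemma simplex_coordinate_continuous s (v : V) :
  continuous (fun x : simplex s => val x v : R).
Proof.
move=> x; apply: (@continuous_comp _ _ _ (val : simplex s -> coordinates)
  (fun y : coordinates => y v)).
  exact: (@initial_continuous _ _ (val : simplex s -> coordinates) x).
exact: coordinate_continuous.
Qed.

Fact simplex_incl_subproof K s (x : simplex s) : K s ->
  val x \in [set t : V -> R | exists2 s, K s & closed_simplex s t].
Proof. by move=> Ks; apply/mem_set; exists s => //; exact: simplexP. Qed.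

Definition simplex_incl K s (Ks : K s) (x : simplex s) : realization R K :=
  exist _ (val x) (simplex_incl_subproof x Ks).

Lemma realizationP K (x : realization R K) :
  exists2 s, K s & closed_simplex s (val x).
Proof. exact: set_valP x. Qed.

Lemma simplex_inclP K (x : realization R K) s (Ks : K s) :
  closed_simplex s (val x) -> exists y, simplex_incl Ks y = x.
Proof.
move=> sx; exists (exist _ (val x) (mem_set sx)); exact: val_inj.
Qed.

Lemma realization_open_simplex K (U : set (realization R K)) :
  (forall s (Ks : K s), open (simplex_incl Ks @^-1` U)) -> open U.
Proof.
move=> oU; suff : realization_open U by [].
move=> s Ks; have [O oO OE] := oU s Ks; exists O => // x sx.
have [y <-] := simplex_inclP Ks sx.
change ((simplex_incl Ks @^-1` U) y <-> (val @^-1` O) y).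
by rewrite -OE.
Qed.

Lemma continuous_from_realization K (Z : topologicalType)
    (f : realization R K -> Z) :
  (forall s (Ks : K s), continuous (f \o simplex_incl Ks)) -> continuous f.
Proof.
move=> fc; apply/continuousP => W oW; apply: realization_open_simplex => s Ks.
by have /continuousP := fc s Ks; exact.
Qed.

(** The converse direction, into a realization, fails for coordinatewise continuity alone;
    [continuous_to_realization] below adds a finiteness condition. *)
Lemma continuous_to_realization K (S : topologicalType)
    (f : S -> realization R K) (l : seq {fset V}) :
  (forall v, continuous (fun x => val (f x) v : R)) ->
  (forall x, exists2 s, s \in l & K s /\ closed_simplex s (val (f x))) ->
  continuous f.
Proof.
move=> fc fl x0 W; rewrite nbhsE => -[U [oU Ux0] UW].
have vfc : continuous (fun x => val (f x) : coordinates).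
  exact: prod_topology_continuous.
have near1 s : \forall x \near x0, K s -> closed_simplex s (val (f x)) ->
    U (f x).
  have [Ks|nKs] := pselect (K s); last by apply: nearW.
  have [O oO OE] := (oU : realization_open U) s Ks.
  have [sx0|nsx0] := pselect (closed_simplex s (val (f x0))).
    have : \forall x \near x0, O (val (f x)).
      have Ox0 : O (val (f x0)) by apply/OE.
      exact: (vfc x0 O (open_nbhs_nbhs (conj oO Ox0))).
    by apply: filterS => x Ox _ sx; apply/OE.
  have : \forall x \near x0, ~ closed_simplex s (val (f x)).
    have oN := closed_openC (@closed_closed_simplex s).
    exact: (vfc x0 _ (open_nbhs_nbhs (conj oN nsx0))).
  by apply: filterS => x nsx _ sx.
have nearl : \forall x \near x0, forall s, s \in l -> K s ->
    closed_simplex s (val (f x)) -> U (f x).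
  elim: l {fl} => [|s l IH]; first by apply: nearW.
  apply: filterS2 (near1 s) IH => x xs xl s'; rewrite inE => /predU1P[->//|].
  exact: xl.
apply: filterS nearl => x xl; apply: UW.
by have [s sl [Ks sx]] := fl x; exact: xl sl Ks sx.
Qed.

End realization.

Section collapse.

Lemma collapse_map_continuous (Y : topologicalType) (A : set Y) :
  continuous (@collapse_map Y A).
Proof. by apply/continuousP. Qed.

Lemma collapse_mapP (Y : topologicalType) (A : set Y) (y : Y) :
  A y -> collapse_map A y = point.
Proof. by move=> Ay; apply: insubF; apply/negP => /set_mem. Qed.

Lemma collapse_mapN (Y : topologicalType) (A : set Y) (y : Y) (nAy : ~ A y) :
  collapse_map A y = Some (exist _ y (mem_set nAy)).
Proof.
rewrite /collapse_map; case: insubP => [u _ uy|].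
  by congr Some; apply: val_inj.
by rewrite mem_set.
Qed.

Definition collapse_lift (Y : topologicalType) (A : set Y) (Z : Type) (z : Z)
  (f : Y -> Z) (q : collapse A) : Z := if q is Some y then f (val y) else z.

Lemma collapse_lift_map (Y : topologicalType) (A : set Y) (Z : Type) (z : Z)
    (f : Y -> Z) : (forall y, A y -> f y = z) ->
  forall y, collapse_lift z f (collapse_map A y) = f y.
Proof.
move=> fA y; have [Ay|nAy] := pselect (A y).
  by rewrite collapse_mapP// fA.
by rewrite (collapse_mapN nAy).
Qed.

Lemma collapse_lift_continuous (Y Z : topologicalType) (A : set Y) (z : Z)
    (f : Y -> Z) : (forall y, A y -> f y = z) ->
  continuous f -> continuous (@collapse_lift Y A Z z f).
Proof.
move=> fA /continuousP fc; apply/continuousP => W oW.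
suff : collapse_open (@collapse_lift Y A Z z f @^-1` W) by [].
rewrite /collapse_open (_ : @collapse_map Y A @^-1` _ = f @^-1` W).
  exact: fc.
by apply/seteqP; split => y /=; rewrite collapse_lift_map.
Qed.

Lemma collapse_case (Y : topologicalType) (A : set Y) (q : collapse A) :
  q = point \/ exists2 y, ~ A y & q = collapse_map A y.
Proof.
case: q => [[y yA]|]; [right|by left].
have nAy := set_mem yA; exists y => //.
by rewrite (collapse_mapN nAy); congr Some; exact: val_inj.
Qed.

End collapse.

(** * The deformation *)

Section layers.
Context (R : realType) (V : choiceType).
Implicit Types (x : V -> R) (M N : {fset V}) (b : R).

Lemma big_fpowersetU1 (F : {fset V} -> R) v N : v \notin N ->
  \sum_(M <- fpowerset (v |` N)%fset) F M =
  \sum_(M <- fpowerset N) (F M + F (v |` M)%fset).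
Proof.
move=> vN; have vM M : (M `<=` N)%fset -> v \notin M.
  by move=> MN; apply: contra vN; apply/fsubsetP.
rewrite big_split /= -(big_map (fun M => v |` M)%fset xpredT F) -big_cat /=.
apply: perm_big; apply: uniq_perm.
- exact: fset_uniq.
- rewrite cat_uniq fset_uniq map_inj_in_uniq ?fset_uniq ?andbT /=.
    apply/hasPn => _ /mapP[M _ ->] /=; apply/negP; rewrite fpowersetE.
    by move=> /vM; rewrite fset1U1.
  move=> M M'; rewrite !fpowersetE => MN M'N E.
  by rewrite -(fsetU1K (vM _ MN)) E fsetU1K// vM.
- move=> M; rewrite mem_cat !fpowersetE; apply/idP/orP => [MvN|[MN|]].
  + have [vinM|vnM] := boolP (v \in M); [right|left].
      apply/mapP; exists (M `\ v)%fset; last by rewrite fsetD1K.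
      by rewrite fpowersetE fsubDset.
    apply/fsubsetP => w wM; move/fsubsetP/(_ w wM): MvN.
    by rewrite !inE => /predU1P[wv|//]; rewrite -wv wM in vnM.
  + by rewrite (fsubset_trans MN)// fsubsetUr.
  + by move=> /mapP[M' M'N ->]; rewrite fsetUS// -fpowersetE.
Qed.

Lemma bigmin_base x b c (r : seq V) :
  \big[Num.min/Num.min b c]_(v <- r) x v =
  Num.min c (\big[Num.min/b]_(v <- r) x v).
Proof.
by elim: r => [|v r IH]; rewrite ?big_nil ?big_cons ?IH minC// minCA minC.
Qed.

Lemma bigmin_fsetU1 x b v M : v \notin M ->
  \big[Num.min/b]_(w <- (v |` M)%fset) x w =
  Num.min (x v) (\big[Num.min/b]_(w <- M) x w).
Proof.
move=> vM; rewrite -[RHS](big_cons _ _ v M xpredT x); apply: perm_big.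
by apply: uniq_perm; rewrite ?fset_uniq//= ?vM ?fset_uniq// => w; rewrite !inE.
Qed.

Lemma bigmax_fsetU1 x b v M : v \notin M ->
  \big[Num.max/b]_(w <- (v |` M)%fset) x w =
  Num.max (x v) (\big[Num.max/b]_(w <- M) x w).
Proof.
move=> vM; rewrite -[RHS](big_cons _ _ v M xpredT x); apply: perm_big.
by apply: uniq_perm; rewrite ?fset_uniq//= ?vM ?fset_uniq// => w; rewrite !inE.
Qed.

(* The length of the set of levels [0 <= c < b] at which [M] is the superlevel
   set [{v in N | x v > c}]. *)
Definition layer x N b M : R :=
  Num.max 0 (\big[Num.min/b]_(v <- M) x v -
             \big[Num.max/0]_(v <- (N `\` M)%fset) x v).

Lemma layer_ge0 x N b M : 0 <= layer x N b M.
Proof. by rewrite le_max lexx. Qed.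

Lemma layer_gt0 x N b M : 0 < layer x N b M ->
  [/\ 0 < b, forall v, v \in M -> 0 < x v,
      forall v w, v \in M -> w \in N -> w \notin M -> x w < x v &
      forall w, w \in N -> w \notin M -> x w < b].
Proof.
rewrite /layer lt_max ltxx /= subr_gt0; set m := \big[Num.min/_]_(_ <- _) _.
set c := \big[Num.max/_]_(_ <- _) _ => cm.
have mv v : v \in M -> c < x v.
  by move=> vM; rewrite (lt_le_trans cm)// ge_bigmin_seq.
have cw w : w \in N -> w \notin M -> x w <= c.
  by move=> wN wM; rewrite le_bigmax_seq// inE wM.
split => [|v vM|v w vM wN wM|w wN wM].
- have c0 : 0 <= c by rewrite /c bigmax_ge_id.
  exact: (lt_le_trans (le_lt_trans c0 cm) (bigmin_le_id _ _ _ _)).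
- by rewrite (le_lt_trans _ (mv v vM))// bigmax_ge_id.
- by rewrite (le_lt_trans (cw w wN wM))// mv.
- by rewrite (le_lt_trans (cw w wN wM))// (lt_le_trans cm)// bigmin_le_id.
Qed.

Lemma layer_eq0 x N b M : ~ 0 < layer x N b M -> layer x N b M = 0.
Proof. by move=> /negP; rewrite lt_def layer_ge0 andbT negbK => /eqP. Qed.

(** Each level in [[0, b)] has exactly one superlevel set, so the layers partition this interval. *)
Lemma layer_sum x N b : \sum_(M <- fpowerset N) layer x N b M = Num.max 0 b.
Proof.
elim/fset1U_rect: N b => [|v N vN IH] b.
  rewrite fpowerset0 big_seq_fset1 /layer fsetD0 (size0nil (cardfs0 V)).
  by rewrite !big_nil subr0.
rewrite big_fpowersetU1// -[RHS]IH; apply: eq_big_seq => M.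
rewrite fpowersetE => MN.
have vM : v \notin M by apply: contra vN; apply/fsubsetP.
rewrite /layer.
have -> : ((v |` N) `\` M = v |` (N `\` M))%fset.
  by apply/fsetP => w; rewrite !inE; case: eqP => // ->; rewrite vM.
have -> : ((v |` N) `\` (v |` M) = N `\` M)%fset.
  apply/fsetP => w; rewrite !inE; case: eqP => //= ->.
  by rewrite (negbTE vN) andbF.
rewrite bigmin_fsetU1// bigmax_fsetU1 ?inE ?(negbTE vN) ?andbF//.
set m := \big[Num.min/_]_(_ <- _) _; set c := \big[Num.max/_]_(_ <- _) _.
(* The interval of levels from [c] to [m] is cut at [x v]: below the cut [v] belongs to the
   superlevel set, above it does not. *)
by rewrite /Num.max /Num.min; repeat case: ifPn => //; rewrite -?leNgt; lra.
Qed.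

(** Putting [v] into [M] only lowers the bound [b] to [min b (x v)], which reduces the sum to
    [layer_sum] over [N] without [v]. *)
Lemma layer_sum_mem x N b v : v \in N ->
  \sum_(M <- fpowerset N | v \in M) layer x N b M =
  Num.max 0 (Num.min b (x v)).
Proof.
move=> vN; rewrite big_mkcond -(fsetD1K vN) big_fpowersetU1 ?fsetD11//.
rewrite -(layer_sum x (N `\ v)%fset); apply: eq_big_seq => M.
rewrite fpowersetE => MN; have vM : v \notin M.
  by apply: contraT; rewrite negbK => /(fsubsetP MN); rewrite !inE eqxx.
rewrite (negbTE vM) add0r fset1U1 /layer bigmin_fsetU1// bigmin_base.
congr (Num.max 0 (_ - _)); congr bigop; congr enum_fset.
apply/fsetP => w; rewrite !inE; case: eqP => //= ->.
by rewrite andbF.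
Qed.

(** Both sets are superlevel sets of the same function, whatever the bounds [b] and [c]. *)
Lemma layer_nested x N b c M M' : (M `<=` N)%fset -> (M' `<=` N)%fset ->
  0 < layer x N b M -> 0 < layer x N c M' ->
  (M `<=` M')%fset || (M' `<=` M)%fset.
Proof.
move=> MN M'N /layer_gt0[_ _ lt1 _] /layer_gt0[_ _ lt2 _].
apply: contraT; rewrite negb_or.
move=> /andP[/fsubsetPn[v vM vM'] /fsubsetPn[w wM' wM]].
have := lt1 v w vM (fsubsetP M'N _ wM') wM.
by have := lt2 w v wM' (fsubsetP MN _ vM) vM'; lra.
Qed.

(** The maximum in [layer] has base value 0, so vertices of mass zero do not affect it. *)
Lemma layer_widen x N N' b M : (M `<=` N)%fset -> (N `<=` N')%fset ->
  (forall v, v \in N' -> v \notin N -> x v = 0) ->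
  layer x N b M = layer x N' b M.
Proof.
move=> MN NN' x0; rewrite /layer; congr (Num.max 0 (_ - _)).
have ub (r : seq V) c : 0 <= c -> (forall v, v \in r -> x v <= c) ->
    \big[Num.max/0]_(v <- r) x v <= c.
  move=> c0 rc; rewrite big_seq; elim/big_ind: _ => // a a' ac a'c.
  by rewrite ge_max ac.
apply/le_anti/andP; split; apply: ub; rewrite ?bigmax_ge_id// => v.
  rewrite !inE => /andP[vM vN]; rewrite le_bigmax_seq// !inE vM.
  exact: (fsubsetP NN').
rewrite !inE => /andP[vM vN']; have [vN|vN] := boolP (v \in N).
  by rewrite le_bigmax_seq// !inE vM.
by rewrite x0// bigmax_ge_id.
Qed.

End layers.

Section deformation.
Context (R : realType) (V : choiceType) (A B : pred V) (p : {fset V} -> V).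
Implicit Types (s M : {fset V}) (K : set {fset V}) (x : V -> R).

Definition outer v := A v || B v.
Definition outer_part s := [fset v in s | outer v]%fset.
Definition mixed M := has A M && has B M.

Lemma mixedS M M' : (M `<=` M')%fset -> mixed M -> mixed M'.
Proof.
move=> /fsubsetP MM' /andP[/hasP[a aM Aa] /hasP[b bM Bb]].
by apply/andP; split; apply/hasP; [exists a|exists b] => //; exact: MM'.
Qed.

(* The point [x] is moved for a time [t], at unit speed: while the outer
   vertices of its support form a mixed set [M], all of them lose mass at unit
   rate, and [p M] receives that mass. *)
Definition push s (t : R) x v : R :=
  x v + \sum_(M <- fpowerset (outer_part s) | mixed M)
    layer x (outer_part s) t M *
    (#|` M|%:R * (v == p M)%:R - (v \in M)%:R).

(** The inserted vertex is not outer, so it leaves the outer part unchanged and never loses mass.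
    The condition is to hold for the complex and for its short subcomplex with the same [p], so that
    one formula deforms both. *)
Definition insertion_closed K :=
  (forall s s', K s -> (s' `<=` s)%fset -> s' != fset0 -> K s') /\
  (forall s, K s -> mixed (outer_part s) ->
    ~~ outer (p (outer_part s)) /\ K (p (outer_part s) |` s)%fset).

Lemma outer_partS s s' : (s `<=` s')%fset ->
  (outer_part s `<=` outer_part s')%fset.
Proof.
move=> ss'; apply/fsubsetP => v; rewrite !inE /= => /andP[vs ->].
by rewrite (fsubsetP ss').
Qed.

Lemma closed_simplex_sub s s' x : (s `<=` s')%fset ->
  (forall v, v \notin s -> x v = 0) ->
  closed_simplex s' x -> closed_simplex s x.
Proof.
move=> ss' xs [x0 xs' x1]; split => //.
by rewrite -x1; apply: big_fset_incl => // v _; exact: xs.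
Qed.

Lemma closed_simplex_le1 s x v : closed_simplex s x -> x v <= 1.
Proof.
move=> [x0 xs x1]; have [vs|/xs ->] := boolP (v \in s); last exact: ler01.
by rewrite -x1 (big_fsetD1 v)//= lerDl; apply: sumr_ge0.
Qed.

(** The sets [M] that occur only for [s'] contain a vertex of mass zero, and their layers are
    empty. *)
Lemma push_widen s s' t x : (s `<=` s')%fset ->
  (forall v, 0 <= x v) -> (forall v, v \notin s -> x v = 0) ->
  push s t x = push s' t x.
Proof.
move=> ss' x0 xs; apply/funext => v; congr (_ + _).
rewrite [LHS]big_mkcond [RHS]big_mkcond /=.
set F := (X in _ = \big[_/_]_(M <- _) X M).
rewrite -(@big_fset_incl _ _ _ _ (fpowerset (outer_part s)) _ F) /=.
- apply: eq_big_seq => M; rewrite fpowersetE => MN.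
  rewrite /F; case: ifP => // _; congr (_ * _); apply: layer_widen => //.
    exact: outer_partS.
  move=> w; rewrite !inE /= => /andP[ws' ow] wNs; apply: xs.
  by move: wNs; rewrite ow andbT.
- by rewrite fpowersetS outer_partS.
- move=> M; rewrite !fpowersetE => MN' /fsubsetPn[w wM wN].
  rewrite /F; case: ifP => // _.
  rewrite layer_eq0 ?mul0r// => /layer_gt0[_ /(_ w wM) + _ _].
  rewrite xs ?ltxx//; apply: contra wN => ws.
  by move/fsubsetP/(_ w wM): MN'; rewrite !inE ws => /andP[].
Qed.

(** Points with unmixed support do not move, since a layer vanishes as soon as its set contains a
    vertex of mass zero. *)
Lemma push_id s t x : (forall M, mixed M -> exists2 v, v \in M & x v = 0) ->
  push s t x = x.
Proof.
move=> mix0; apply/funext => v; rewrite /push big1 ?addr0// => M /mix0[w wM xw].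
rewrite layer_eq0 ?mul0r// => /layer_gt0[_ /(_ w wM) + _ _].
by rewrite xw ltxx.
Qed.

Lemma push0 s x : push s 0 x = x.
Proof.
apply/funext => v; rewrite /push big1 ?addr0// => M _.
by rewrite layer_eq0 ?mul0r// => /layer_gt0[]; rewrite ltxx.
Qed.

Section carrier.
Context (K : set {fset V}) (Kp : insertion_closed K).

Let inner_part s := [fset v in s | ~~ outer v]%fset.

(** [insertion_closed] speaks of whole outer parts; it is applied to the face of [s] spanned by [M]
    and the inner vertices, whose outer part is [M]. *)
Lemma insertion_closed_outer s M : K s -> (M `<=` outer_part s)%fset ->
  mixed M -> K (p M |` (inner_part s `|` M))%fset /\ ~~ outer (p M).
Proof.
move=> Ks MN mM; have E : outer_part (inner_part s `|` M)%fset = M.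
  apply/fsetP => v; rewrite !inE /=; apply/andP/idP => [[/orP[/andP[_ /negP]|]]//|].
  move=> vM; rewrite vM orbT; split => //.
  by move/fsubsetP/(_ v vM): MN; rewrite !inE /= => /andP[].
have KM : K (inner_part s `|` M)%fset.
  apply: (Kp.1 _ _ Ks).
    apply/fsubsetP => v; rewrite !inE /= => /orP[/andP[]//|/(fsubsetP MN)].
    by rewrite !inE /= => /andP[].
  move/andP: mM => [/hasP[a aM _] _]; apply/fset0Pn; exists a.
  by rewrite !inE aM orbT.
by have := Kp.2 _ KM; rewrite E => /(_ mM)[].
Qed.

(** The list decreases. Cutting the outer part down to [M] and adding [p M] gives a simplex of [K]
    with outer part [M], into which the next insertion is made. Hence all inserted vertices span one
    simplex with the inner part and the last set of the list, although they were chosen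
    separately. *)
Lemma nested_carrier (l : seq {fset V}) s : K s ->
  pairwise (fun M M' => M' `<=` M)%fset l ->
  (forall M, M \in l -> mixed M /\ (M `<=` outer_part s)%fset) ->
  exists2 s', K s' & forall v,
    (v \in s') = [|| v \in inner_part s, v \in last (outer_part s) l |
                     v \in map p l].
Proof.
elim: l s => [|M l IH] s Ks /=.
  move=> _ _; exists s => // v; rewrite !inE /= orbF.
  by case: (v \in s) => //=; case: outer.
move=> /andP[/allP lM pl] lP; have [mM MN] := lP M (mem_head _ _).
have [Ks2 op] := insertion_closed_outer Ks MN mM.
set s2 := (p M |` _)%fset in Ks2.
have E : outer_part s2 = M.
  apply/fsetP => v; rewrite !inE /=; apply/andP/idP.
    case=> + ov => /or3P[/eqP vp|/andP[_]|//]; last by rewrite ov.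
    by rewrite vp (negbTE op) in ov.
  move=> vM; rewrite vM !orbT; split => //.
  by move/fsubsetP/(_ v vM): MN; rewrite !inE /= => /andP[].
have [|s' Ks' s'E] := IH s2 Ks2 pl.
  move=> M' M'l; rewrite E; split; last exact: lM.
  by apply: (lP M' _).1; rewrite inE M'l orbT.
exists s' => // v; rewrite s'E E !inE /=.
case: (eqVneq v (p M)) => [->|_] /=; first by rewrite op !orbT.
have [vM|_] := boolP (v \in M); last by rewrite orbF -andbA andbb.
move/fsubsetP/(_ v vM): MN; rewrite !inE /= => /andP[_ ->].
by rewrite !andbF.
Qed.

Lemma push_outer s t x v : K s -> outer v ->
  push s t x v = x v -
    \sum_(M <- fpowerset (outer_part s) | mixed M && (v \in M))
      layer x (outer_part s) t M.
Proof.
move=> Ks ov; rewrite /push -sumrN; congr (_ + _).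
rewrite [RHS]big_mkcondr /= [LHS]big_seq_cond [RHS]big_seq_cond.
apply: eq_bigr => M; rewrite fpowersetE => /andP[MN mM].
have -> : v == p M = false.
  apply/negbTE; apply: contraTneq ov => ->.
  exact: (insertion_closed_outer Ks MN mM).2.
by rewrite mulr0 sub0r mulrN; case: ifP; rewrite ?mulr1 ?mulr0 ?oppr0.
Qed.

Lemma push_inner s t x v : ~~ outer v -> x v <= push s t x v.
Proof.
move=> ov; rewrite /push lerDl big_seq_cond; apply: sumr_ge0 => M.
rewrite fpowersetE => /andP[MN _].
have -> : v \in M = false.
  apply/negbTE; apply: contra ov => /(fsubsetP MN).
  by rewrite !inE /= => /andP[].
by rewrite subr0 mulr_ge0 ?layer_ge0// -natrM ler0n.
Qed.

(** A vertex missing from a mixed superlevel set has already been emptied: the superlevel sets that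
    contain [v] contain [M], so they are mixed too, and [v] loses mass at all levels below [x v],
    which is less than [t]. *)
Lemma layer_sum_mixed s t x v M : K s -> closed_simplex s x ->
  v \in outer_part s ->
  (M `<=` outer_part s)%fset -> mixed M -> v \notin M ->
  0 < layer x (outer_part s) t M ->
  \sum_(M <- fpowerset (outer_part s) | mixed M && (v \in M))
    layer x (outer_part s) t M = x v.
Proof.
move=> Ks [x0 _ _] vs MN mM vM M0.
have [_ _ _ /(_ v vs vM)xvt] := layer_gt0 M0.
transitivity (\sum_(M <- fpowerset (outer_part s) | v \in M)
    layer x (outer_part s) t M); last first.
  by rewrite layer_sum_mem// min_r ?max_r// ltW.
rewrite big_mkcondl /= [LHS]big_seq_cond [RHS]big_seq_cond.
apply: eq_bigr => M' /andP[]; rewrite fpowersetE => M'N vM'.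
case: ifPn => // nmM'; rewrite layer_eq0// => M'0.
have := layer_nested MN M'N M0 M'0 => /orP[/mixedS/(_ mM)|/fsubsetP/(_ v vM')].
  exact/negP.
exact/negP.
Qed.

(** The carrier consists of the inner vertices, the smallest mixed superlevel set reached before
    time [t], and the vertices inserted so far. The last clause bounds it by a finite set
    independent of [t] and [x], as [continuous_to_realization] requires. *)
Lemma push_carrier s t x : K s -> closed_simplex s x ->
  exists s', [/\ K s', closed_simplex s' (push s t x) &
    (s' `<=` s `|` [fset p M | M in fpowerset (outer_part s)])%fset].
Proof.
move=> Ks sx; have [x0 xs x1] := sx; set N := outer_part s.
set S := (s `|` _)%fset.
pose l0 := [seq M <- fpowerset N | mixed M & 0 < layer x N t M].
(* Nested sets sorted by decreasing cardinality are sorted by inclusion. *)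
pose l := sort (fun M M' : {fset V} => (#|` M'| <= #|` M|)%N) l0.
have lP M : (M \in l) = [&& (M `<=` N)%fset, mixed M & 0 < layer x N t M].
  by rewrite mem_sort mem_filter fpowersetE andbC.
have pl : pairwise (fun M M' => M' `<=` M)%fset l.
  have : pairwise (fun M M' : {fset V} => (#|` M'| <= #|` M|)%N) l.
    rewrite -sorted_pairwise.
      by apply: sort_sorted => M M'; exact: leq_total.
    by move=> M M' M'' MM' M'M''; exact: leq_trans M'M'' MM'.
  apply: sub_in_pairwise (allss l) => M M'; rewrite !lP.
  move=> /and3P[MN _ M0] /and3P[M'N _ M'0] M'M.
  have /orP[MM'|//] := layer_nested MN M'N M0 M'0.
  have /eqP -> : M == M' by rewrite eqEfcard MM'.
  exact: fsubset_refl.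
have [|s' Ks' s'E] := nested_carrier Ks pl.
  by move=> M; rewrite lP => /and3P[].
exists s'.
have s'S : (s' `<=` S)%fset.
  apply/fsubsetP => v; rewrite s'E in_fsetU => /or3P[|vl|/mapP[M]].
  - by rewrite !inE /= => /andP[->].
  - apply/orP; left.
    have lN : (last N l `<=` N)%fset.
      have := mem_last N l; rewrite inE => /predU1P[->|].
        exact: fsubset_refl.
      by rewrite lP => /and3P[].
    by move/fsubsetP/(_ v vl): lN; rewrite !inE => /andP[].
  - rewrite lP => /and3P[MN _ _] ->; apply/orP; right.
    by apply/imfsetP; exists M => //=; rewrite fpowersetE.
(* [S] need not belong to [K]; it serves to compute the total mass, once the coordinates off [s']
   are known to vanish. *)
split => //; apply: (closed_simplex_sub s'S).
  move=> v; rewrite s'E !negb_or => /and3P[vi vl vp].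
  have vpM M : (M `<=` N)%fset -> mixed M -> v == p M -> layer x N t M = 0.
    move=> MN mM /eqP vpM; apply: layer_eq0 => M0; move/negP: vp; apply.
    by rewrite vpM map_f// lP MN mM.
  have pushE : push s t x v = x v -
      \sum_(M <- fpowerset N | mixed M && (v \in M)) layer x N t M.
    rewrite /push -sumrN; congr (_ + _); rewrite [RHS]big_mkcondr /=.
    rewrite [LHS]big_seq_cond [RHS]big_seq_cond; apply: eq_bigr => M.
    rewrite fpowersetE => /andP[MN mM].
    have [/(vpM M MN mM) ->|_] := boolP (v == p M).
      by rewrite mul0r; case: ifP; rewrite ?oppr0.
    by rewrite mulr0 sub0r mulrN; case: ifP; rewrite ?mulr1 ?mulr0 ?oppr0.
  have [vs|vs] := boolP (v \in s); last first.
    rewrite pushE xs// sub0r big1_seq ?oppr0// => M /andP[/andP[_ vM]].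
    rewrite fpowersetE => /fsubsetP/(_ v vM).
    by rewrite !inE (negbTE vs).
  have ov : outer v by move: vi; rewrite !inE /= vs /= negbK.
  have vN : v \in N by rewrite !inE /= vs.
  have ll : last N l \in l.
    have := mem_last N l; rewrite inE => /predU1P[E|//].
    by rewrite E vN in vl.
  have := ll; rewrite lP => /and3P[MN mM M0].
  by rewrite pushE (layer_sum_mixed Ks sx vN MN mM vl M0) subrr.
split.
- move=> v; have [ov|ov] := boolP (outer v); last first.
    exact: le_trans (x0 v) (push_inner _ _ _ ov).
  rewrite (push_outer _ _ Ks ov) subr_ge0.
  have [vN|vN] := boolP (v \in N); last first.
    rewrite big1_seq// => M /andP[/andP[_ vM]].
    by rewrite fpowersetE => /fsubsetP/(_ v vM) vN'; rewrite vN' in vN.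
  apply: (@le_trans _ _ (\sum_(M <- fpowerset N | v \in M) layer x N t M)).
    rewrite big_mkcondl; apply: ler_sum => M _; case: ifP => // _.
    exact: layer_ge0.
  by rewrite layer_sum_mem// ge_max x0 ge_min lexx orbT.
- move=> v; rewrite !inE negb_or => /andP[vs vp].
  rewrite /push xs// add0r big1_seq// => M /andP[_]; rewrite fpowersetE => MN.
  have -> : v == p M = false.
    apply/negbTE; apply: contra vp => /eqP ->; apply/imfsetP; exists M => //=.
    by rewrite fpowersetE.
  have -> : v \in M = false.
    by apply/negbTE; apply: contra vs => /(fsubsetP MN); rewrite !inE => /andP[].
  by rewrite mulr0 subr0 mulr0.
(* Mass is conserved for each [M] separately: what [p M] receives is the layer times the cardinal of
   [M]. *)
- rewrite /push big_split /= exchange_big /= [X in _ + X]big1_seq ?addr0.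
    rewrite -x1; apply/esym; apply: big_fset_incl; first exact: fsubsetUl.
    by move=> v _; exact: xs.
  move=> M /andP[_]; rewrite fpowersetE => MN.
  rewrite -mulr_sumr sumrB -mulr_sumr.
  rewrite (big_fsetD1 (p M)) /=; last first.
    rewrite inE; apply/orP; right; apply/imfsetP; exists M => //=.
    by rewrite fpowersetE.
  rewrite eqxx big1_seq ?addr0 ?mulr1; last first.
    by move=> v /andP[_]; rewrite in_fsetD1 => /andP[/negbTE -> _].
  rewrite (_ : \sum_(i <- S) (i \in M)%:R = #|` M|%:R) ?subrr ?mulr0//.
  have MS : (M `<=` S)%fset.
    apply: fsubset_trans (fsubsetUl _ _); apply: (fsubset_trans MN).
    by apply/fsubsetP => v; rewrite !inE => /andP[].
  transitivity (\sum_(i <- M) 1 : R); last first.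
    by rewrite big_const_seq count_predT iter_addr_0.
  rewrite -(@big_fset_incl _ _ _ _ _ _ (fun i => (i \in M)%:R : R) MS).
    by apply: eq_big_seq => v ->.
  by move=> v _ /negbTE ->.
Qed.

(** At time 1 an outer vertex retains mass only if it lies in an unmixed superlevel set with
    nonempty layer. Two such sets, around [a] and around [b], would be nested, and the larger one
    would be mixed. *)
Lemma push1_unmixed s x a b : K s -> closed_simplex s x -> A a -> B b ->
  push s 1 x a != 0 -> push s 1 x b = 0.
Proof.
move=> Ks sx Aa Bb ya; apply/eqP; apply: contraT => yb.
have [x0 xs _] := sx.
have level v : outer v -> push s 1 x v != 0 ->
    exists M, [/\ (M `<=` outer_part s)%fset, ~~ mixed M, v \in M &
      0 < layer x (outer_part s) 1 M].
  move=> ov yv; have [|no] := pselect (exists M, [/\ (M `<=` outer_part s)%fset,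
    ~~ mixed M, v \in M & 0 < layer x (outer_part s) 1 M]); first by [].
  exfalso; move/eqP: yv; apply.
  rewrite (push_outer _ _ Ks ov).
  have [vs|vs] := boolP (v \in s); last first.
    rewrite xs// sub0r big1_seq ?oppr0// => M /andP[/andP[_ vM]].
    rewrite fpowersetE => /fsubsetP/(_ v vM).
    by rewrite !inE (negbTE vs).
  have vN : v \in outer_part s by rewrite !inE /= vs.
  rewrite [X in _ - X](_ : _ = x v) ?subrr//.
  transitivity (\sum_(M <- fpowerset (outer_part s) | v \in M)
      layer x (outer_part s) 1 M); last first.
    by rewrite layer_sum_mem// min_r ?max_r// (closed_simplex_le1 _ sx).
  rewrite big_mkcondl /= [LHS]big_seq_cond [RHS]big_seq_cond.
  apply: eq_bigr => M /andP[]; rewrite fpowersetE => MN vM.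
  case: ifPn => // nmM; rewrite layer_eq0// => M0.
  by apply: no; exists M.
have [|M [MN nM aM M0]] := level a _ ya; first by rewrite /outer Aa.
have [|M' [M'N nM' bM' M'0]] := level b _ yb; first by rewrite /outer Bb orbT.
have /orP[/fsubsetP MM'|/fsubsetP M'M] := layer_nested MN M'N M0 M'0.
  move/negP: nM'; case; apply/andP; split; apply/hasP; [exists a|exists b] => //.
  exact: MM'.
move/negP: nM; case; apply/andP; split; apply/hasP; [exists a|exists b] => //.
exact: M'M.
Qed.

End carrier.
End deformation.

(** * The deformation on the realization and on its quotient *)

Section deformation_retraction.
Context (R : realType) (V : choiceType) (A B : pred V) (p : {fset V} -> V).
Implicit Types (s M : {fset V}) (x : V -> R).

Local Notation N := (outer_part A B).
Local Notation mixed := (mixed A B).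
Local Notation push := (push A B p).

Lemma continuous_maxr (T : topologicalType) (f g : T -> R) :
  continuous f -> continuous g ->
  continuous (fun z => Num.max (f z) (g z)).
Proof. by move=> fc gc z; exact: (@continuous_max R T f g z (fc z) (gc z)). Qed.

Lemma continuous_minr (T : topologicalType) (f g : T -> R) :
  continuous f -> continuous g ->
  continuous (fun z => Num.min (f z) (g z)).
Proof. by move=> fc gc z; exact: (@continuous_min R T f g z (fc z) (gc z)). Qed.

Lemma continuous_bigminr (T : topologicalType) (f : T -> R) (g : V -> T -> R)
    (r : seq V) : continuous f -> (forall v, continuous (g v)) ->
  continuous (fun z => \big[Num.min/f z]_(v <- r) g v z).
Proof.
move=> fc gc; elim: r => [|v r IH]; first by under eq_fun do rewrite big_nil.
by under eq_fun do rewrite big_cons; exact: continuous_minr.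
Qed.

Lemma continuous_bigmaxr (T : topologicalType) (f : T -> R) (g : V -> T -> R)
    (r : seq V) : continuous f -> (forall v, continuous (g v)) ->
  continuous (fun z => \big[Num.max/f z]_(v <- r) g v z).
Proof.
move=> fc gc; elim: r => [|v r IH]; first by under eq_fun do rewrite big_nil.
by under eq_fun do rewrite big_cons; exact: continuous_maxr.
Qed.

Lemma layer_continuous (T : topologicalType) (t : T -> R) (x : T -> V -> R)
    M M' : continuous t -> (forall w, continuous (fun z => x z w)) ->
  continuous (fun z => layer (x z) M (t z) M').
Proof.
move=> tc xc; have c0 : continuous (fun _ : T => 0 : R).
  by move=> z; exact: cvg_cst.
have minc := @continuous_bigminr _ t (fun v z => x z v) M' tc xc.
have maxc := @continuous_bigmaxr _ _ (fun v z => x z v) (M `\` M')%fset c0 xc.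
apply: (continuous_maxr c0) => z.
by apply: cvgB; [exact: minc|exact: maxc].
Qed.

Lemma push_continuous (T : topologicalType) (t : T -> R) (x : T -> V -> R)
    s v : continuous t -> (forall w, continuous (fun z => x z w)) ->
  continuous (fun z => push s (t z) (x z) v).
Proof.
move=> tc xc z; apply: cvgD; first exact: xc.
move: z; apply: continuous_big; first exact: add_continuous.
move=> M _ z; apply: cvgM; last exact: cvg_cst.
exact: layer_continuous.
Qed.

Context (K K' : set {fset V}).
Hypotheses (Kp : insertion_closed A B p K) (K'p : insertion_closed A B p K').

Lemma push_indep s s' t x : closed_simplex s x -> closed_simplex s' x ->
  push s t x = push s' t x.
Proof.
move=> [x0 xs _] [_ xs' _].
rewrite (push_widen _ _ _ _ (fsubsetUl s s'))//.
by rewrite (push_widen _ _ _ _ (fsubsetUr s s')).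
Qed.

(** An arbitrary simplex containing the point, not necessarily its support; [push_indep] shows that
    the choice does not affect [push]. *)
Definition carrier (x : realization R K) : {fset V} :=
  s2val (cid2 (realizationP x)).

Lemma carrierP (x : realization R K) :
  K (carrier x) /\ closed_simplex (carrier x) (val x).
Proof. by rewrite /carrier; case: cid2. Qed.

Fact deform_subproof (t : R) (x : realization R K) :
  push (carrier x) t (val x) \in
    [set t : V -> R | exists2 s, K s & closed_simplex s t].
Proof.
have [Ks sx] := carrierP x; apply/mem_set.
by have [s' [Ks' s'x _]] := push_carrier Kp t Ks sx; exists s'.
Qed.

Definition deform (t : R) (x : realization R K) : realization R K :=
  exist _ (push (carrier x) t (val x)) (deform_subproof t x).

Lemma val_deform t (x : realization R K) s :
  closed_simplex s (val x) -> val (deform t x) = push s t (val x).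
Proof. by move=> sx /=; apply: push_indep => //; exact: (carrierP x).2. Qed.

Lemma val_deform_incl t s (Ks : K s) (x : simplex R s) :
  val (deform t (simplex_incl Ks x)) = push s t (val x).
Proof. by rewrite (val_deform t (s := s))//; exact: simplexP. Qed.

Lemma deform_sub t (x : realization R K) :
  subrealization K' x -> subrealization K' (deform t x).
Proof.
move=> [s K's sx]; have [s' [K's' s'x _]] := push_carrier K'p t K's sx.
by exists s' => //; rewrite (val_deform t sx).
Qed.

Definition unmixed_subcomplex : set {fset V} := [set s | K s /\ ~~ mixed (N s)].

(** The simplex given by [push_carrier] may still contain emptied outer vertices; its face on the
    support is unmixed. *)
Lemma push1_carrier s x : K s -> closed_simplex s x ->
  exists2 s', unmixed_subcomplex s' & closed_simplex s' (push s 1 x) /\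
    (s' `<=` s `|` [fset p M | M in fpowerset (N s)])%fset.
Proof.
move=> Ks sx; have [s1 [Ks1 s1x s1S]] := push_carrier Kp 1 Ks sx.
pose s' := [fset v in s1 | push s 1 x v != 0]%fset.
have s's1 : (s' `<=` s1)%fset.
  by apply/fsubsetP => v; rewrite !inE => /andP[].
have s'x : closed_simplex s' (push s 1 x).
  apply: (closed_simplex_sub s's1 _ s1x) => v; rewrite !inE /=.
  case: eqP => [//|y0]; rewrite andbT => vs1.
  by have [_ /(_ _ vs1)] := s1x.
exists s'; last by split => //; exact: fsubset_trans s1S.
split.
  apply: (Kp.1 _ _ Ks1 s's1); apply/negP => /eqP E.
  by have [_ _] := s'x; rewrite E big_seq_fset0 => /esym/eqP; rewrite oner_eq0.
apply/negP => /andP[/hasP[a aN Aa] /hasP[b bN Bb]].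
move: aN bN; rewrite !inE /= => /andP[/andP[_ ya] _] /andP[/andP[_ /eqP yb] _].
exact/yb/(push1_unmixed Kp Ks sx Aa Bb ya).
Qed.

Fact retract_subproof (x : realization R K) : val (deform 1 x) \in
  [set t : V -> R | exists2 s, unmixed_subcomplex s & closed_simplex s t].
Proof.
have [Ks sx] := carrierP x; apply/mem_set.
by have [s' Ls' [s'x _]] := push1_carrier Ks sx; exists s'.
Qed.

Definition retract (x : realization R K) : realization R unmixed_subcomplex :=
  exist _ (val (deform 1 x)) (retract_subproof x).

Lemma retract_continuous : continuous retract.
Proof.
apply: continuous_from_realization => s Ks.
apply: (@continuous_to_realization _ _ _ _ _
  (fpowerset (s `|` [fset p M | M in fpowerset (N s)])%fset)) => [v|x].
  have -> : (fun x : simplex R s => val ((retract \o simplex_incl Ks) x) v) =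
      (fun x : simplex R s => push s 1 (val x) v).
    by apply/funext => x; rewrite -(val_deform_incl 1 Ks).
  have c1 : continuous (fun _ : simplex R s => 1 : R).
    exact: cst_continuous.
  apply: (@push_continuous _ _ (fun x : simplex R s => val x) _ _ c1) => w.
  exact: simplex_coordinate_continuous.
have [s' Ls' [s'x s'S]] := push1_carrier Ks (simplexP x).
exists s'; first by rewrite fpowersetE.
split=> //.
by rewrite -(val_deform_incl 1 Ks) in s'x.
Qed.

Local Notation proj :=
  (@collapse_map (realization R K) (subrealization K')).

Definition deform_collapse
    (z : R * @collapse (realization R K) (subrealization K')) :
    @collapse (realization R K) (subrealization K') :=
  collapse_lift None (fun x : realization R K => proj (deform z.1 x)) z.2.

Lemma deform_collapse_map t (x : realization R K) :
  deform_collapse (t, proj x) = proj (deform t x).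
Proof.
rewrite /deform_collapse collapse_lift_map// => y K'y.
by rewrite collapse_mapP//; exact: deform_sub.
Qed.

Lemma deform_collapse0 q : deform_collapse (0, q) = q.
Proof.
have [->//|[x _ ->]] := collapse_case q.
rewrite deform_collapse_map; congr (proj _); apply: val_inj.
by rewrite (val_deform 0 (carrierP x).2) push0.
Qed.

Lemma deform_collapse_continuous : continuous deform_collapse.
Proof.
have cH s (Ks : K s) : continuous (fun z : R * simplex R s =>
    deform_collapse (z.1, proj (simplex_incl Ks z.2))).
  rewrite (_ : (fun _ => _) = proj \o (fun z : R * simplex R s =>
    deform z.1 (simplex_incl Ks z.2))); last first.
    by apply/funext => z; exact: deform_collapse_map.
  move=> z; apply: continuous_comp; last exact: collapse_map_continuous.
  move: z; apply: (@continuous_to_realization _ _ _ _ _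
    (fpowerset (s `|` [fset p M | M in fpowerset (N s)])%fset)) => [v|z].
    have -> : (fun z : R * simplex R s =>
          val (deform z.1 (simplex_incl Ks z.2)) v) =
        (fun z : R * simplex R s => push s z.1 (val z.2) v).
      apply/funext => z.
      by rewrite val_deform_incl.
    have c1 : continuous (fun z : R * simplex R s => z.1).
      by move=> z; exact: cvg_fst.
    apply: (@push_continuous _ _ (fun z : R * simplex R s => val z.2) _ _ c1).
    move=> w z; apply: (@continuous_comp _ _ _ snd
      (fun x : simplex R s => val x w)).
      exact: cvg_snd.
    exact: simplex_coordinate_continuous.
  have [s' [Ks' s'x s'S]] := push_carrier Kp z.1 Ks (simplexP z.2).
  exists s'; first by rewrite fpowersetE.
  split=> //.
  by rewrite val_deform_incl.
pose Q := @collapse (realization R K) (subrealization K').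
apply: (@final_prod_continuous R Q Q {s | K s}
  (fun i => simplex R (proj1_sig i))
  (fun i (x : simplex R (proj1_sig i)) => proj (simplex_incl (proj2_sig i) x))
  deform_collapse).
- move=> U oU; suff : collapse_open U by [].
  by apply: realization_open_simplex => s Ks; exact: (oU (exist _ s Ks)).
- by move=> [s Ks]; exact: cH.
(* The base point is treated apart: no simplex reaches it when the collapsed subspace is empty. *)
- move=> q; have [->|[x _ ->]] := collapse_case q.
    by move=> t; exact: cvg_cst.
  have [Ks sx] := carrierP x; have [y <-] := simplex_inclP Ks sx.
  move=> t; apply: (@continuous_comp _ _ _ (fun t => (t, y))
    (fun z : R * simplex R (carrier x) =>
      deform_collapse (z.1, proj (simplex_incl Ks z.2)))).
    have c1 : continuous (fun _ : R => y) by exact: cst_continuous.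
    exact: (cvg_pair (@cvg_id _ (nbhs t)) (c1 t)).
  exact: cH.
Qed.

End deformation_retraction.

(** * Chains in the causal order *)

Section order_complex.
Context (d : Order.disp_t) (P : porderType d).
Implicit Types (s : {fset P}) (c : seq P).

Lemma order_complexP s : order_complex P s <->
  s != fset0 /\ (forall u v, u \in s -> v \in s -> (u <= v)%O || (v <= u)%O).
Proof.
split=> [[c /andP[c0 cs] <-]|[s0 tot]].
  split.
    case: c c0 {cs} => // u c _; apply/fset0Pn; exists u.
    by rewrite !inE eqxx.
  move: cs; rewrite (sorted_pairwise lt_trans) => cs u v; rewrite !inE => uc vc.
  elim: c cs uc vc {c0} => // w c IH /= /andP[/allP wc cs].
  rewrite !inE => /predU1P[->|uc] /predU1P[->|vc].
  - by rewrite lexx.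
  - by rewrite ltW// wc.
  - by rewrite orbC ltW// wc.
  - exact: IH.
exists (sort <=%O s); last by apply/fsetP => u; rewrite !inE mem_sort.
rewrite /= /chain; apply/andP; split.
  apply: contraNneq s0 => E; apply/eqP/fsetP => u.
  by rewrite -(mem_sort <=%O) E.
rewrite lt_sorted_uniq_le sort_uniq fset_uniq /=.
apply: (@sort_sorted_in _ (mem s)); last exact/allP.
by move=> u v us vs; exact: tot.
Qed.

End order_complex.

(** * Chains of length [l] *)

Section full_chains.
Context (R : realType) (X : metricType R) (l : R).
Local Notation Cau := (Cau l X).
Implicit Types (u v w : Cau) (s : {fset Cau}) (c : seq Cau).

Definition time u : R := (Cau_event u).2.

(** Lightlike separation: equality in the causal inequality. *)
Definition null u v : Prop :=
  mdist (Cau_point u) (Cau_point v) = time v - time u.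

Lemma Cau_leE u v : (u <= v)%O = (tag u == tag v) &&
  (mdist (Cau_point u) (Cau_point v) <= time v - time u).
Proof. by []. Qed.

Lemma Cau_dist_le u v : (u <= v)%O ->
  mdist (Cau_point u) (Cau_point v) <= time v - time u.
Proof. by rewrite Cau_leE => /andP[]. Qed.

Lemma Cau_tag u v : (u <= v)%O -> tag u = tag v.
Proof. by rewrite Cau_leE => /andP[/eqP]. Qed.

Lemma Cau_betweenP u : [/\ 0 <= time u <= l,
  mdist (tag u).1 (Cau_point u) <= time u &
  mdist (Cau_point u) (tag u).2 <= l - time u].
Proof. by case: u => ab p; exact: (set_valP p). Qed.

Lemma Cau_eq u v : tag u = tag v -> Cau_point u = Cau_point v ->
  time u = time v -> u = v.
Proof.
case: u v => [ab p] [ab' p'] /= E; subst ab'.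
rewrite /Cau_point /time /Cau_event /= => E1 E2; congr existT; apply: val_inj.
move: E1 E2; rewrite /=; case: (sval p) => x t.
by case: (sval p') => y t' /= -> ->.
Qed.

Lemma time_le u v : (u <= v)%O -> time u <= time v.
Proof.
move=> /Cau_dist_le.
by have := mdist_ge0 (Cau_point u) (Cau_point v); lra.
Qed.

Lemma Cau_le_time_eq u v : (u <= v)%O -> time v <= time u -> u = v.
Proof.
move=> uv vu; have := Cau_dist_le uv; have := time_le uv => t1 t2.
have t3 := mdist_ge0 (Cau_point u) (Cau_point v).
apply: Cau_eq; [exact: Cau_tag| |by lra].
by apply: mdist_positivity; lra.
Qed.

Lemma time_lt u v : (u < v)%O -> time u < time v.
Proof.
move=> uv; rewrite ltNge; apply/negP => vu.
by move: (uv); rewrite (Cau_le_time_eq (ltW uv) vu) ltxx.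
Qed.

Lemma null_refl u : null u u.
Proof. by rewrite /null mdistxx subrr. Qed.

Lemma null_trans v u w : (u <= v)%O -> (v <= w)%O -> null u w ->
  null u v /\ null v w.
Proof.
move=> /Cau_dist_le uv /Cau_dist_le vw; rewrite /null => uw.
have := metric_triangle (Cau_point u) (Cau_point v) (Cau_point w).
by split; lra.
Qed.

Lemma null_trans_sub v v' u w : (u <= v)%O -> (v <= v')%O -> (v' <= w)%O ->
  null u w -> null v v'.
Proof.
move=> uv vv' v'w uw; have [_ vw] := null_trans uv (le_trans vv' v'w) uw.
by have [] := null_trans vv' v'w vw.
Qed.

(* A chain of total length [l], in two forms that are convenient respectively
   to prove and to use. *)
Definition full_adjacent s : Prop :=
  [/\ exists2 u, u \in s & time u = 0, exists2 u, u \in s & time u = l &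
      forall u v, u \in s -> v \in s -> (u < v)%O ->
        null u v \/ exists2 w, w \in s & (u < w)%O && (w < v)%O].

Definition full_cover s : Prop :=
  forall t : R, 0 <= t <= l -> exists u v,
    [/\ u \in s, v \in s, (u <= v)%O, null u v & time u <= t <= time v].

(** Monotonicity is immediate for covers but not for adjacency, because new vertices create new
    adjacent pairs. Closure of short chains under faces rests on it. *)
Lemma full_coverS s s' : (s `<=` s')%fset -> full_cover s -> full_cover s'.
Proof.
move=> /fsubsetP ss' fs t /fs[u [v [us vs uv n tuv]]].
by exists u, v; split; rewrite ?ss'.
Qed.

Lemma path_length_le u c : sorted <%O (u :: c) ->
  path_length (map (@Cau_point R l X) (u :: c)) <= time (last u c) - time u.
Proof.
elim: c u => [|v c IH] u /=; first by rewrite big_nil subrr.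
move=> /andP[uv vc]; rewrite big_cons.
have := IH v vc; rewrite /path_length /= => {}IH.
by have := Cau_dist_le (ltW uv); lra.
Qed.

(** Every step is at most as long as the time it takes, so equality in total makes every step null;
    one of the steps contains [t]. *)
Lemma path_length_cover u c (t : R) : sorted <%O (u :: c) ->
  time (last u c) - time u <= path_length (map (@Cau_point R l X) (u :: c)) ->
  time u <= t <= time (last u c) -> exists v w,
    [/\ v \in u :: c, w \in u :: c, (v <= w)%O, null v w &
        time v <= t <= time w].
Proof.
elim: c u => [|v c IH] u /=.
  by move=> _ _ ut; exists u, u; split; rewrite ?mem_head//; exact: null_refl.
move=> /andP[uv vc]; rewrite big_cons => len /andP[ut tl].
have := path_length_le vc; rewrite {1}/path_length /= => le.
have d := Cau_dist_le (ltW uv).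
have [tv|vt] := leP t (time v).
  exists u, v; split; rewrite ?inE ?eqxx ?orbT//; first exact: ltW.
  - by rewrite /null; lra.
  - by rewrite ut.
have [||v' [w [v'c wc v'w n t']]] := IH v vc.
- by rewrite /path_length /=; lra.
- by rewrite (ltW vt).
by exists v', w; split => //; rewrite inE ?v'c ?wc orbT.
Qed.

Lemma path_length_adjacent u c : sorted <%O (u :: c) ->
  (forall v w, v \in u :: c -> w \in u :: c -> (v < w)%O ->
    null v w \/ exists2 z, z \in u :: c & (v < z)%O && (z < w)%O) ->
  path_length (map (@Cau_point R l X) (u :: c)) = time (last u c) - time u.
Proof.
elim: c u => [|v c IH] u /=; first by rewrite big_nil subrr.
move=> uvc; have /andP[uv vc] := uvc.
have ulast z : z \in v :: c -> (u < z)%O.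
  by have /allP := order_path_min lt_trans (uvc : path _ u (v :: c)); exact.
have vlast z : z \in v :: c -> (v <= z)%O.
  rewrite inE => /predU1P[->//|zc].
  by have /allP/(_ z zc)/ltW := order_path_min lt_trans vc.
move=> adj; rewrite big_cons; have := IH v vc; rewrite /path_length /= => ->.
  have [|->|[z]] := adj u v (mem_head _ _) _ uv.
  - by rewrite !inE eqxx orbT.
  - by lra.
  move=> zc /andP[uz zv]; move: zc; rewrite inE => /predU1P[zu|/vlast].
    by move: uz; rewrite zu ltxx.
  by move=> /(lt_le_trans zv); rewrite ltxx.
move=> a b ac bc ab.
have [||n|[z zc /andP[az zb]]] := adj a b _ _ ab.
- by rewrite in_cons ac orbT.
- by rewrite in_cons bc orbT.
- by left.
right; exists z; last by rewrite az.
move: zc; rewrite inE => /predU1P[zu|//].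
by have := lt_trans (ulast a ac) az; rewrite zu ltxx.
Qed.

Lemma full_cover_adjacent s : 0 <= l ->
  order_complex Cau s -> full_cover s -> full_adjacent s.
Proof.
move=> l0 /order_complexP[_ tot] fs; split.
- have [|u [_ [us _ _ _ /andP[u0 _]]]] := fs 0; first by rewrite lexx.
  by exists u => //; have [/andP[]] := Cau_betweenP u; lra.
- have [|_ [u [_ us _ _ /andP[_ u0]]]] := fs l; first by rewrite lexx andbT.
  by exists u => //; have [/andP[]] := Cau_betweenP u; lra.
move=> a b sa sb ab.
have [ex|nex] := pselect (exists2 w, w \in s & (a < w)%O && (w < b)%O).
  by right.
left; have tab := time_lt ab.
have [/andP[a0 _] _ _] := Cau_betweenP a.
have [/andP[_ b1] _ _] := Cau_betweenP b.
(* No vertex lies strictly between [a] and [b], so a null pair around the midpoint of their times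
   encloses both. *)
have [|u [v [us vs uv n /andP[uc cv]]]] := fs ((time a + time b) / 2).
  by apply/andP; split; lra.
have adj w : w \in s -> (w <= a)%O || (b <= w)%O.
  move=> ws; apply: contraT; rewrite negb_or => /andP[wa bw].
  exfalso; apply: nex; exists w => //; apply/andP; split.
    have := tot _ _ ws sa; rewrite (negbTE wa) /= le_eqVlt => /predU1P[E|//].
    by rewrite E lexx in wa.
  have := tot _ _ ws sb; rewrite (negbTE bw) orbF le_eqVlt => /predU1P[E|//].
  by rewrite E lexx in bw.
have ua : (u <= a)%O.
  by have /orP[//|/time_le bu] := adj u us; exfalso; lra.
have bv : (b <= v)%O.
  by have /orP[/time_le va|//] := adj v vs; exfalso; lra.
exact: null_trans_sub ua (ltW ab) bv n.
Qed.

(** The cover at [time z] bounds only times; comparability turns this into order, since comparable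
    events of equal time coincide. *)
Lemma full_between s z : full_cover s ->
  (forall u, u \in s -> (u <= z)%O || (z <= u)%O) ->
  exists u v, [/\ u \in s, v \in s, (u <= z)%O, (z <= v)%O & null u v].
Proof.
move=> fs cmp; have [zl _ _] := Cau_betweenP z.
have [u [v [us vs uv n /andP[uz zv]]]] := fs _ zl.
exists u, v; split=> //.
  have /orP[//|zu] := cmp u us.
  by rewrite (Cau_le_time_eq zu uz).
have /orP[vz|//] := cmp v vs.
by rewrite (Cau_le_time_eq vz zv).
Qed.

Lemma full_adjacent_length c : chain c -> full_adjacent [fset u in c]%fset ->
  l <= path_length (map (@Cau_point R l X) c).
Proof.
move=> chc [[u0 us0 u00] [u1 us1 u1l] adj].
case: c chc us0 us1 adj => // u c /andP[_ uc].
have mem z : (z \in [fset z in u :: c]%fset) = (z \in u :: c) by rewrite !inE.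
rewrite !mem => us0 us1 adj.
rewrite path_length_adjacent//; last first.
  move=> v w vc wc vw; have [||n|[z zc zvw]] := adj v w _ _ vw.
  - by rewrite mem.
  - by rewrite mem.
  - by left.
  - by right; exists z; rewrite -?mem.
have umin z : z \in u :: c -> (u <= z)%O.
  rewrite inE => /predU1P[->//|zc].
  by have /allP/(_ z zc)/ltW := order_path_min lt_trans uc.
have umax z : z \in u :: c -> (z <= last u c)%O.
  move: uc; clear mem umin us0 us1 adj; elim: c u z => [|v c' IH] u z.
    by rewrite inE => _ /eqP ->.
  rewrite inE => /= /andP[uv vc] /predU1P[->|]; last exact: IH.
  exact: le_trans (ltW uv) (IH v v vc (mem_head _ _)).
have := time_le (umin _ us0); have := time_le (umax _ us1).
by have [/andP[]] := Cau_betweenP u; lra.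
Qed.

Lemma length_full_cover c : chain c ->
  l <= path_length (map (@Cau_point R l X) c) -> full_cover [fset u in c]%fset.
Proof.
case: c => // u c /andP[_ uc] len t /andP[t0 tl].
have le := path_length_le uc.
have [/andP[u0 _] _ _] := Cau_betweenP u.
have [/andP[_ ul] _ _] := Cau_betweenP (last u c).
have [||v [w [vc wc vw n tvw]]] := path_length_cover (t := t) uc.
- by lra.
- by apply/andP; split; lra.
by exists v, w; split => //; move: vc wc; rewrite !inE.
Qed.

Lemma full_adjacent_cover s :
  order_complex Cau s -> full_adjacent s -> full_cover s.
Proof.
by move=> [c chc <-] /(full_adjacent_length chc); exact: length_full_cover.
Qed.

Lemma short_complexP s : 0 <= l ->
  short_complex s <-> order_complex Cau s /\ ~ full_adjacent s.
Proof.
move=> l0; split=> [[c [chc len] <-]|[sK nf]].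
  split; first by exists c.
  by move=> /(full_adjacent_length chc); lra.
have [c chc cs] := sK; exists c => //; split => //.
rewrite ltNge; apply/negP => len; apply: nf; apply: full_cover_adjacent => //.
by rewrite -cs; exact: length_full_cover.
Qed.

Lemma order_complexS s s' : order_complex Cau s -> (s' `<=` s)%fset ->
  s' != fset0 -> order_complex Cau s'.
Proof.
move=> /order_complexP[_ tot] /fsubsetP s's s'0; apply/order_complexP.
by split => // u v /s's us /s's vs; exact: tot.
Qed.

Lemma short_complexS s s' : 0 <= l -> short_complex s -> (s' `<=` s)%fset ->
  s' != fset0 -> short_complex s'.
Proof.
move=> l0 /(short_complexP _ l0)[sK nf] s's s'0; apply/short_complexP => //.
have s'K := order_complexS sK s's s'0; split => // /(full_adjacent_cover s'K).
by move=> /(full_coverS s's)/(full_cover_adjacent l0 sK).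
Qed.

(** Deleting [q] creates a single new adjacent pair, and [ins] says that the two null steps through
    [q] compose to a null step. As [a] and [b] enclose [q], it is neither the event at time 0 nor
    the one at time [l]. *)
Lemma full_insert s q a b : order_complex Cau s ->
  a \in s -> b \in s -> (a < q)%O -> (q < b)%O ->
  (forall x y, x \in s -> y \in s -> (a <= x)%O -> (x < q)%O -> (q < y)%O ->
     (y <= b)%O -> null x q -> null q y -> null x y) ->
  full_adjacent (q |` s)%fset -> full_adjacent s.
Proof.
move=> /order_complexP[_ tot] sa sb aq qb ins [[u0 us0 u00] [u1 us1 u1l] adj].
have [/andP[a0 _] _ _] := Cau_betweenP a.
have [/andP[_ bl] _ _] := Cau_betweenP b.
have taq := time_lt aq; have tqb := time_lt qb.
split.
- exists u0 => //; move: us0; rewrite !inE => /predU1P[E|//].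
  by move: taq; rewrite -E u00 ltNge a0.
- exists u1 => //; move: us1; rewrite !inE => /predU1P[E|//].
  by move: tqb; rewrite -E u1l ltNge bl.
move=> u v us vs uv.
have [|nex] := pselect (exists2 w, w \in s & (u < w)%O && (w < v)%O).
  by right.
left; have no w : w \in s -> (u < w)%O -> (w < v)%O -> False.
  by move=> ws uw wv; apply: nex; exists w => //; rewrite uw.
have sq w : w \in s -> w \in (q |` s)%fset by rewrite !inE => ->; rewrite orbT.
have [//|[w + /andP[uw wv]]] := adj u v (sq _ us) (sq _ vs) uv.
rewrite !inE => /predU1P[wq|ws]; last by have := no w ws uw wv.
rewrite wq in uw wv.
have nuq : null u q.
  have [//|[z + /andP[uz zq]]] := adj u q (sq _ us) (fset1U1 _ _) uw.
  rewrite !inE => /predU1P[E|zs]; first by rewrite E ltxx in zq.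
  by have := no z zs uz (lt_trans zq wv).
have nqv : null q v.
  have [//|[z + /andP[qz zv]]] := adj q v (fset1U1 _ _) (sq _ vs) wv.
  rewrite !inE => /predU1P[E|zs]; first by rewrite E ltxx in qz.
  by have := no z zs (lt_trans uw qz) zv.
apply: ins => //.
  have /orP[//|] := tot a u sa us; rewrite le_eqVlt => /predU1P[->//|ua].
  by have := no a sa ua (lt_trans aq wv).
have /orP[//|] := tot v b vs sb; rewrite le_eqVlt => /predU1P[->//|bv].
by have := no b sb (lt_trans uw qb) bv.
Qed.

End full_chains.

(** * Insertion of projection points into mixed chains *)

Section gates.
Context (R : realType) (X : metricType R) (l : R) (inG inH : set X).
Hypothesis cover : forall x, inG x \/ inH x.
Hypothesis projX : forall y, ~ inG y -> exists q, [/\ inG q, inH q &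
  forall x, inG x -> mdist x y = mdist x q + mdist q y].
Local Notation Cau := (Cau l X).
Local Notation pt := (@Cau_point R l X).
Implicit Types (u v w q g h k : Cau) (s M : {fset Cau}).

Definition offG u : bool := `[< ~ inG (pt u) >].
Definition offH u : bool := `[< ~ inH (pt u) >].

Local Notation outer := (outer offH offG).
Local Notation outer_part := (outer_part offH offG).
Local Notation mixed := (mixed offH offG).

Lemma not_outer u : inG (pt u) -> inH (pt u) -> ~~ outer u.
Proof. by move=> Gu Hu; apply/norP; split; apply/asboolP; case. Qed.

Lemma Cau_exists u (y : X) (t : R) : 0 <= t <= l ->
  mdist (tag u).1 y <= t -> mdist y (tag u).2 <= l - t ->
  exists q, [/\ tag q = tag u, pt q = y & time q = t].
Proof.
move=> tl ay yb.
have yt : (y, t) \in Cau_between l (tag u).1 (tag u).2 by exact/mem_set.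
by exists (existT _ (tag u) (exist _ (y, t) yt)).
Qed.

(** [q] is the latest event over the projection of [pt h] from which [h] can be reached. Distances
    from [inG] to [pt h] split at the projection, so everything over [inG] before [h] is before
    [q]. *)
Lemma gate_before g h : inG (pt g) -> ~ inG (pt h) -> (g < h)%O ->
  exists q, [/\ inG (pt q), inH (pt q), (q < h)%O, null q h &
    forall k, inG (pt k) -> (k <= h)%O ->
      (k <= q)%O /\
      mdist (pt k) (pt h) = mdist (pt k) (pt q) + mdist (pt q) (pt h)].
Proof.
move=> Gg Gh gh; have [q0 [Gq Hq dq]] := projX Gh.
have gh' := Cau_dist_le (ltW gh); rewrite dq// in gh'.
have [/andP[g0 _] ag _] := Cau_betweenP g.
have [/andP[_ hl] _ hb] := Cau_betweenP h.
rewrite (Cau_tag (ltW gh)) in ag.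
(* The end point [(tag h).1] may lie outside [inG], so its distance to [q0] is bounded through
   [g]. *)
have tri1 := metric_triangle (tag h).1 (pt g) q0.
have tri2 := metric_triangle q0 (pt h) (tag h).2.
have d0 := mdist_ge0 (pt g) q0; have d1 := mdist_ge0 q0 (pt h).
have [| | |q [qt qE tq]] := @Cau_exists h q0 (time h - mdist q0 (pt h)).
- by apply/andP; split; lra.
- by lra.
- by lra.
exists q; rewrite qE; split => //.
- rewrite lt_neqAle; apply/andP; split.
    by apply/eqP => E; apply: Gh; rewrite -E qE.
  by rewrite Cau_leE qt eqxx qE tq; apply/andP; split => //; lra.
- by rewrite /null qE tq; lra.
move=> k Gk kh; split; last exact: dq.
rewrite Cau_leE qt (Cau_tag kh) eqxx qE tq /=.
by have := Cau_dist_le kh; rewrite dq//; lra.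
Qed.

(** Time reversal of [gate_before]: [q] is now the earliest event over the projection that can be
    reached from [h]. *)
Lemma gate_after g h : inG (pt g) -> ~ inG (pt h) -> (h < g)%O ->
  exists q, [/\ inG (pt q), inH (pt q), (h < q)%O, null h q &
    forall k, inG (pt k) -> (h <= k)%O ->
      (q <= k)%O /\
      mdist (pt h) (pt k) = mdist (pt h) (pt q) + mdist (pt q) (pt k)].
Proof.
move=> Gg Gh hg; have [q0 [Gq Hq dq']] := projX Gh.
have dq x : inG x -> mdist (pt h) x = mdist (pt h) q0 + mdist q0 x.
  by move=> Gx; rewrite metric_sym dq'// addrC (metric_sym q0) (metric_sym x).
have hg' := Cau_dist_le (ltW hg); rewrite dq// in hg'.
have [/andP[_ gl] _ gb] := Cau_betweenP g.
have [/andP[h0 _] ah _] := Cau_betweenP h.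
rewrite -(Cau_tag (ltW hg)) in gb.
have tri1 := metric_triangle (tag h).1 (pt h) q0.
have tri2 := metric_triangle q0 (pt g) (tag h).2.
have d0 := mdist_ge0 q0 (pt g); have d1 := mdist_ge0 (pt h) q0.
have [| | |q [qt qE tq]] := @Cau_exists h q0 (time h + mdist (pt h) q0).
- by apply/andP; split; lra.
- by lra.
- by lra.
exists q; rewrite qE; split => //.
- rewrite lt_neqAle; apply/andP; split.
    by apply/eqP => E; apply: Gh; rewrite E qE.
  by rewrite Cau_leE qt eqxx qE tq; apply/andP; split => //; lra.
- by rewrite /null qE tq; lra.
move=> k Gk hk; split; last exact: dq.
rewrite Cau_leE qt (Cau_tag hk) eqxx qE tq /=.
by have := Cau_dist_le hk; rewrite dq//; lra.
Qed.

Definition adjacent M g h : Prop := [/\ g \in M, h \in M, (g < h)%O &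
  forall w, w \in M -> ~~ ((g < w)%O && (w < h)%O)].

(** [M] records only outer vertices, while a chain with outer part [M] may have vertices over the
    intersection between [g] and [h]. The factorization through [q] is therefore required for every
    [k] over [inG] on the relevant side of [h], and not for [g] alone. *)
Definition gate M q : Prop := inG (pt q) /\ inH (pt q) /\ exists g h,
  offH g /\ offG h /\
  ([/\ adjacent M g h, (q < h)%O, null q h &
    forall k, inG (pt k) -> (k <= h)%O ->
      (k <= q)%O /\
      mdist (pt k) (pt h) = mdist (pt k) (pt q) + mdist (pt q) (pt h)] \/
   [/\ adjacent M h g, (h < q)%O, null h q &
    forall k, inG (pt k) -> (h <= k)%O ->
      (q <= k)%O /\
      mdist (pt h) (pt k) = mdist (pt h) (pt q) + mdist (pt q) (pt k)]).

Lemma offH_inG u : offH u -> inG (pt u).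
Proof. by move=> /asboolP; case: (cover (pt u)). Qed.

(** A discrete intermediate value argument: an element strictly between [a] and [b] differs in kind
    from one of them, and replacing the other leaves fewer elements in between. *)
Lemma adjacent_exists M (a b : Cau) : (forall w, w \in M -> outer w) ->
  a \in M -> b \in M -> (a < b)%O -> offH a != offH b ->
  exists g h, adjacent M g h /\ offH g != offH h.
Proof.
move=> Mo; have [n] := ubnP #|` [fset w in M | (a < w)%O && (w < b)%O]%fset|.
elim: n a b => // n IH a b + aM bM ab ne.
set I := [fset w in M | _]%fset => In.
have [I0|/fset0Pn[w]] := eqVneq I fset0.
  exists a, b; split => //; split => // w wM; apply/negP => awb.
  by have : w \in fset0 by rewrite -I0 !inE wM.
rewrite !inE => /and3P[wM aw wb].
have sub (J : {fset Cau}) : (J `<=` I)%fset -> w \notin J -> (#|` J| < n)%N.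
  move=> JI wJ; rewrite ltnS in In; apply: leq_trans In.
  apply: fproper_ltn_card; rewrite fproperE JI; apply/fsubsetPn; exists w => //.
  by rewrite !inE wM aw.
have [aw'|aw'] := eqVneq (offH a) (offH w).
  apply: (IH w b) => //; last by rewrite -aw'.
  apply: sub; last by rewrite !inE ltxx /= andbF.
  apply/fsubsetP => z; rewrite !inE => /and3P[-> wz ->].
  by rewrite (lt_trans aw wz).
apply: (IH a w) => //; apply: sub; last by rewrite !inE ltxx /= !andbF.
apply/fsubsetP => z; rewrite !inE => /and3P[-> -> zw].
by rewrite (lt_trans zw wb).
Qed.

Lemma gate_exists M : (forall w, w \in M -> outer w) ->
  (forall u v, u \in M -> v \in M -> (u <= v)%O || (v <= u)%O) ->
  mixed M -> exists q, gate M q.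
Proof.
move=> Mo tot /andP[/hasP[a aM oa] /hasP[b bM ob]].
have nob : ~~ offH b.
  apply/negP => /offH_inG Gb; by move/asboolP: ob.
have [g [h [[gM hM gh no] ne]]] :
    exists g h, adjacent M g h /\ offH g != offH h.
  have /orP[] := tot a b aM bM; rewrite le_eqVlt => /predU1P[E|lt].
  - by rewrite E (negbTE nob) in oa.
  - by apply: (adjacent_exists Mo aM bM lt); rewrite oa (negbTE nob).
  - by rewrite -E (negbTE nob) in oa.
  - by apply: (adjacent_exists Mo bM aM lt); rewrite oa (negbTE nob).
have [og|og] := boolP (offH g); rewrite ?og ?(negbTE og) /= in ne.
  have oh : offG h by have := Mo h hM; rewrite /outer; case: (offH h) ne.
  have [q [Gq Hq qh n qk]] := gate_before (offH_inG og) (asboolW oh) gh.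
  exists q; split => //; split => //; exists g, h; split => //.
  by split => //; left.
have oh : offH h by case: (offH h) ne.
have og' : offG g by have := Mo g gM; rewrite /outer (negbTE og).
have [q [Gq Hq qh n qk]] := gate_after (offH_inG oh) (asboolW og') gh.
exists q; split => //; split => //; exists h, g; split => //.
by split => //; right.
Qed.

(** Vertices of [s] strictly between [g] and [h] are not outer, so the gate property puts them all
    on the far side of [q] from [h]. Hence [q] is comparable with all of [s] and is a neighbour of
    [h], and the splitting of distances at [q] composes the two null steps around it. *)
Lemma gate_insert s q : order_complex Cau s -> gate (outer_part s) q ->
  [/\ ~~ outer q, order_complex Cau (q |` s)%fset &
      full_adjacent (q |` s)%fset -> full_adjacent s].
Proof.
move=> sK [Gq [Hq [g [h [og [oh gate_]]]]]].
have /order_complexP[s0 tot] := sK.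
have chain_insert : (forall k, k \in s -> (k <= q)%O || (q <= k)%O) ->
    order_complex Cau (q |` s)%fset.
  move=> cmp; apply/order_complexP; split.
    by apply/fset0Pn; exists q; rewrite fset1U1.
  move=> u v; rewrite !inE => /predU1P[->|us] /predU1P[->|vs].
  - by rewrite lexx.
  - by rewrite orbC cmp.
  - exact: cmp.
  - exact: tot.
have oN u : u \in s -> outer u -> u \in outer_part s.
  by move=> us ou; rewrite !inE us.
have Ninner u : ~~ outer u -> inG (pt u).
  rewrite negb_or => /andP[_] /asboolPn; exact: contrapT.
have sN u : u \in outer_part s -> u \in s by rewrite !inE => /andP[].
have qg : q != g by apply: contraTneq og => <-; apply/asboolPn.
have Gg := offH_inG og.
case: gate_ => [[[gN hN gh no] qh n qk]|[[hN gN hg no] hq n qk]].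
- have gq : (g < q)%O.
    by rewrite lt_neqAle eq_sym qg; exact: (qk g Gg (ltW gh)).1.
  have between k : k \in s -> (g <= k)%O -> (k < h)%O -> inG (pt k).
    move=> ks; rewrite le_eqVlt => /predU1P[<-//|gk] kh.
    apply: Ninner; apply/negP => ok.
    by have := no k (oN k ks ok); rewrite gk kh.
  have cmp k : k \in s -> (k <= q)%O || (h <= k)%O.
    move=> ks; have /orP[kh|->] := tot k h ks (sN _ hN); last by rewrite orbT.
    move: kh; rewrite le_eqVlt => /predU1P[->|kh]; first by rewrite lexx orbT.
    have /orP[kg|gk] := tot k g ks (sN _ gN).
      by rewrite (le_trans kg (ltW gq)).
    by rewrite (qk k (between k ks gk kh) (ltW kh)).1.
  split; first exact: not_outer.
    apply: chain_insert => k /cmp/orP[->//|hk].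
    by rewrite (le_trans (ltW qh) hk) orbT.
  apply: (full_insert sK (sN _ gN) (sN _ hN) gq qh).
  move=> x y xs ys gx xq qy yh nxq nqy.
  (* By [cmp], the first vertex of [s] after [q] is [h]. *)
  have Ey : y = h.
    apply: le_anti; rewrite yh /=; have /orP[yq|//] := cmp y ys.
    by have := le_lt_trans yq qy; rewrite ltxx.
  have xh : (x < h)%O := lt_trans xq qh.
  have [_] := qk x (between x xs gx xh) (ltW xh).
  by move: nxq nqy; rewrite Ey /null; lra.
- have qg' : (q < g)%O.
    by rewrite lt_neqAle qg; exact: (qk g Gg (ltW hg)).1.
  have between k : k \in s -> (k <= g)%O -> (h < k)%O -> inG (pt k).
    move=> ks; rewrite le_eqVlt => /predU1P[->//|kg] hk.
    apply: Ninner; apply/negP => ok.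
    by have := no k (oN k ks ok); rewrite kg hk.
  have cmp k : k \in s -> (q <= k)%O || (k <= h)%O.
    move=> ks; have /orP[->|hk] := tot k h ks (sN _ hN); first by rewrite orbT.
    move: hk; rewrite le_eqVlt => /predU1P[->|hk]; first by rewrite lexx orbT.
    have /orP[kg|gk] := tot k g ks (sN _ gN); last first.
      by rewrite (le_trans (ltW qg') gk).
    by rewrite (qk k (between k ks kg hk) (ltW hk)).1.
  split; first exact: not_outer.
    apply: chain_insert => k /cmp/orP[->|kh]; first by rewrite orbT.
    by rewrite (le_trans kh (ltW hq)).
  apply: (full_insert sK (sN _ hN) (sN _ gN) hq qg').
  move=> x y xs ys hx xq qy yg nxq nqy.
  have Ex : x = h.
    apply: le_anti; rewrite hx andbT; have /orP[qx|//] := cmp x xs.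
    by have := le_lt_trans qx xq; rewrite ltxx.
  have hy : (h < y)%O := lt_trans hq qy.
  have [_] := qk y (between y ys yg hy) (ltW hy).
  by move: nxq nqy; rewrite Ex /null; lra.
Qed.

Section insertion.
Context (q0 : Cau).

(** [q0] is only the default value, taken on sets without a gate. *)
Definition insertion M : Cau := xget q0 (gate M).

Lemma insertionP s : order_complex Cau s -> mixed (outer_part s) ->
  gate (outer_part s) (insertion (outer_part s)).
Proof.
move=> /order_complexP[_ tot] mix; have [w|u v|q qP] := gate_exists _ _ mix.
- by rewrite !inE => /andP[].
- by rewrite !inE => /andP[us _] /andP[vs _]; exact: tot.
exact: (xgetI q0 qP).
Qed.

Lemma order_complex_insertion_closed :
  insertion_closed offH offG insertion (order_complex Cau).
Proof.
split=> [s s' sK s's s'0|s sK mix]; first exact: order_complexS sK s's s'0.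
by have [] := gate_insert sK (insertionP sK mix).
Qed.

Lemma short_complex_insertion_closed : 0 <= l ->
  insertion_closed offH offG insertion (@short_complex R l X).
Proof.
move=> l0; split=> [s s' sK s's s'0|s]; first exact: short_complexS sK s's s'0.
move=> /(short_complexP _ l0)[sK nf] mix.
have [oq qK qf] := gate_insert sK (insertionP sK mix).
by split => //; apply/short_complexP => //; split => // /qf.
Qed.

End insertion.
End gates.

(** * Change of vertices *)

Section barycentric_class.
Context (R : realType) (V : choiceType).
Implicit Types (s : {fset V}) (K : set {fset V}) (x : V -> R).

Definition subset_closed K := forall s s', K s -> (s' `<=` s)%fset ->
  s' != fset0 -> K s'.

Lemma closed_simplex_support s x : closed_simplex s x -> exists s',
  [/\ (s' `<=` s)%fset, s' != fset0, closed_simplex s' x &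
      forall v, (v \in s') = (x v != 0)].
Proof.
move=> sx; have [x0 xs x1] := sx.
have mem v : (v \in [fset v in s | x v != 0]%fset) = (x v != 0).
  rewrite !inE /=; have [_|vs] := boolP (v \in s); first by [].
  by rewrite xs ?eqxx.
have ss : ([fset v in s | x v != 0] `<=` s)%fset.
  by apply/fsubsetP => v; rewrite !inE => /andP[].
have s'x : closed_simplex [fset v in s | x v != 0]%fset x.
  by apply: closed_simplex_sub sx => // v; rewrite mem negbK => /eqP.
exists [fset v in s | x v != 0]%fset; split => //.
apply/negP => /eqP E; have [_ _] := s'x; rewrite E big_seq_fset0.
by move/esym/eqP; rewrite oner_eq0.
Qed.

Context (K K' : set {fset V}).

Local Notation quotient := (@collapse (realization R K) (subrealization K')).

(* The base point if [x] is not a point of the realization. *)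
Definition bary_class x : quotient :=
  if pselect (x \in [set t : V -> R | exists2 s, K s & closed_simplex s t])
  is left h then collapse_map (subrealization K')
    (exist _ x h : realization R K) else None.

Lemma bary_class_val (y : realization R K) :
  bary_class (val y) = collapse_map (subrealization K') y.
Proof.
rewrite /bary_class; case: pselect => [h|]; last by case; exact: valP y.
by congr (collapse_map _ _); exact: val_inj.
Qed.

Lemma bary_classE s x (Ks : K s) (sx : closed_simplex s x) :
  bary_class x = collapse_map (subrealization K')
    (simplex_incl Ks (exist _ x (mem_set sx) : simplex R s)).
Proof. by rewrite -bary_class_val. Qed.

Lemma bary_class_sub s x : K' s -> closed_simplex s x -> bary_class x = None.
Proof.
move=> K's sx; rewrite /bary_class; case: pselect => // h.
by apply: collapse_mapP; exists s.
Qed.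

End barycentric_class.

Section vertex_maps.
Context (R : realType) (V W : choiceType) (J : V -> W).
Hypothesis Jinj : injective J.
Implicit Types (s : {fset V}) (x : V -> R) (y : W -> R).

Definition pushforward x (w : W) : R :=
  if pselect (exists v, J v = w) is left h then x (sval (cid h)) else 0.

Lemma pushforwardE x v : pushforward x (J v) = x v.
Proof.
rewrite /pushforward; case: pselect => [h|[]]; last by exists v.
by case: cid => v' /= /Jinj ->.
Qed.

Lemma pushforward0 x w : ~ (exists v, J v = w) -> pushforward x w = 0.
Proof. by rewrite /pushforward; case: pselect. Qed.

Lemma pushforwardK x : pushforward x \o J = x.
Proof. by apply/funext => v /=; rewrite pushforwardE. Qed.

Lemma pullbackK y : (forall w, y w != 0 -> exists v, J v = w) ->
  pushforward (y \o J) = y.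
Proof.
move=> yJ; apply/funext => w.
have [[v <-]|nw] := pselect (exists v, J v = w); first by rewrite pushforwardE.
rewrite pushforward0//; apply/esym/eqP; apply: contraT => /yJ.
by move=> /nw.
Qed.

Definition fset_image s : {fset W} := [fset J v | v in s]%fset.

Lemma mem_fset_image s v : (J v \in fset_image s) = (v \in s).
Proof. by rewrite mem_imfset. Qed.

Lemma fset_imageP s w : reflect (exists2 v, v \in s & w = J v) (w \in fset_image s).
Proof. exact: imfsetP. Qed.

Lemma big_fset_image s (F : W -> R) :
  \sum_(w <- fset_image s) F w = \sum_(v <- s) F (J v).
Proof. by rewrite big_imfset //= => v v' _ _ /Jinj. Qed.

Lemma fset_image_exists (t : {fset W}) : (forall w, w \in t -> exists v, J v = w) ->
  exists s, t = fset_image s.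
Proof.
elim/fset1U_rect: t => [|w t wt IH] tJ.
  by exists fset0; rewrite /fset_image imfset0.
have [v vw] := tJ w (fset1U1 _ _).
have [s ->] := IH (fun w' w't => tJ w' (fset1Ur w w't)).
exists (v |` s)%fset; apply/fsetP => w'; rewrite !inE -vw.
apply/orP/fset_imageP => [[/eqP ->|/fset_imageP[v' v's ->]]|[v' + ->]].
- by exists v => //; rewrite fset1U1.
- by exists v' => //; rewrite !inE v's orbT.
- by rewrite !inE => /predU1P[->|v's]; [left|right; rewrite mem_fset_image].
Qed.

Lemma closed_simplex_pushforward s x :
  closed_simplex s x -> closed_simplex (fset_image s) (pushforward x).
Proof.
move=> [x0 xs x1]; split.
- move=> w; rewrite /pushforward; case: pselect => // h; exact: x0.
- move=> w ws; have [[v vw]|nw] := pselect (exists v, J v = w).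
    by rewrite -vw pushforwardE xs//; rewrite -mem_fset_image vw.
  by rewrite pushforward0.
- by rewrite big_fset_image -x1; apply: eq_bigr => v _; rewrite pushforwardE.
Qed.

Lemma closed_simplex_pullback s y :
  closed_simplex (fset_image s) y -> closed_simplex s (y \o J).
Proof.
move=> [y0 ys y1]; split => [v|v vs|]; first exact: y0.
  by rewrite /= ys// mem_fset_image.
by rewrite -y1 big_fset_image.
Qed.

Context (K K' : set {fset V}) (L L' : set {fset W}).

Lemma pushforward_class_continuous : (forall s, K s -> L (fset_image s)) ->
  continuous (fun y : realization R K =>
    bary_class L L' (pushforward (val y))).
Proof.
move=> KL; apply: continuous_from_realization => s Ks.
pose F (y : simplex R s) : realization R L := simplex_incl (KL s Ks)
  (exist _ (pushforward (val y))
    (mem_set (closed_simplex_pushforward (simplexP y)))).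
rewrite (_ : _ \o _ = collapse_map (subrealization L') \o F); last first.
  apply/funext => y /=.
  exact: (bary_classE _ (KL s Ks) (closed_simplex_pushforward (simplexP y))).
move=> y; apply: continuous_comp; last exact: collapse_map_continuous.
move: y; apply: (@continuous_to_realization _ _ _ _ F [:: fset_image s]) => [w|y].
  have [[v vw]|nw] := pselect (exists v, J v = w).
    rewrite (_ : (fun _ => _) = (fun y : simplex R s => val y v)).
      exact: simplex_coordinate_continuous.
    by apply/funext => y; rewrite /= -vw pushforwardE.
  rewrite (_ : (fun _ => _) = (fun y : simplex R s => 0)).
    exact: cst_continuous.
  by apply/funext => y; rewrite /= pushforward0.
exists (fset_image s); first by rewrite inE.
by split; [exact: (KL s Ks)|exact: (closed_simplex_pushforward (simplexP y))].
Qed.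

(** The restriction to one simplex ensures total mass one: [y \o J] loses whatever mass [y] has
    outside the image of [J]. *)
Lemma pullback_class_continuous s : K s ->
  continuous (fun y : simplex R (fset_image s) =>
    bary_class K K' (val y \o J : V -> R)).
Proof.
move=> Ks.
pose F (y : simplex R (fset_image s)) : realization R K := simplex_incl Ks
  (exist _ (val y \o J : V -> R)
    (mem_set (closed_simplex_pullback (simplexP y)))).
rewrite (_ : (fun _ => _) = collapse_map (subrealization K') \o F); last first.
  apply/funext => y /=.
  exact: (bary_classE _ Ks (closed_simplex_pullback (simplexP y))).
move=> y; apply: continuous_comp; last exact: collapse_map_continuous.
move: y; apply: (@continuous_to_realization _ _ _ _ F [:: s]) => [v|y].
  exact: (@simplex_coordinate_continuous _ _ (fset_image s) (J v)).
exists s; first by rewrite inE.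
by split => //; exact: (closed_simplex_pullback (simplexP y)).
Qed.

(** If [y \o J] is not a point of the realization, its class is the base point by default; otherwise
    its support is mapped onto a face of [t]. *)
Lemma pullback_class_sub t y : subset_closed L' ->
  (forall s, s != fset0 -> L' (fset_image s) -> K' s) ->
  L' t -> closed_simplex t y -> bary_class K K' (y \o J : V -> R) = None.
Proof.
move=> L'c L'K' L't ty; rewrite /bary_class; case: pselect => // h.
apply: collapse_mapP; have [s _ sy] := set_mem h.
have [s' [_ s'0 s'y s'E]] := closed_simplex_support sy.
exists s' => //; apply: L'K' => //; apply: (L'c t) => //.
  apply/fsubsetP => _ /fset_imageP[v vs' ->].
  apply: contraT => vt; have [_ /(_ _ vt) yv _] := ty.
  by move: vs'; rewrite s'E /= yv eqxx.
have /fset0Pn[v vs'] := s'0; apply/fset0Pn; exists (J v).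
by rewrite mem_fset_image.
Qed.

End vertex_maps.

(** * The wedge decomposition *)

Section isometric_embedding.
Context (R : realType) (l : R) (Y X : metricType R) (j : Y -> X).
Hypothesis isoj : isometric j.
Implicit Types (u v : Cau l Y) (s : {fset Cau l Y}).

Fact Cau_map_subproof u :
  (j (Cau_point u), time u) \in Cau_between l (j (tag u).1) (j (tag u).2).
Proof.
have [u1 u2 u3] := Cau_betweenP u; apply/mem_set.
by split => //=; rewrite isoj.
Qed.

Definition Cau_map u : Cau l X :=
  existT (fun ab => set_type (Cau_between l ab.1 ab.2))
    (j (tag u).1, j (tag u).2)
    (exist _ (j (Cau_point u), time u) (Cau_map_subproof u)).

Lemma Cau_point_map u : Cau_point (Cau_map u) = j (Cau_point u).
Proof. by []. Qed.

Lemma time_map u : time (Cau_map u) = time u.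
Proof. by []. Qed.

Lemma Cau_map_inj : injective Cau_map.
Proof.
have jinj := isometric_inj isoj.
move=> u v uv; apply: Cau_eq.
- have : tag (Cau_map u) = tag (Cau_map v) by rewrite uv.
  rewrite /=; case: (tag u) => a b; case: (tag v) => a' b' /=.
  by move=> [/jinj -> /jinj ->].
- by apply: jinj; rewrite -!Cau_point_map uv.
- by rewrite -!time_map uv.
Qed.

Lemma Cau_map_le u v : (Cau_map u <= Cau_map v)%O = (u <= v)%O.
Proof.
have jinj := isometric_inj isoj.
rewrite !Cau_leE !Cau_point_map isoj; congr (_ && _).
rewrite /=; case: (tag u) => a b; case: (tag v) => a' b' /=.
by rewrite !xpair_eqE !(inj_eq jinj).
Qed.

Lemma Cau_map_lt u v : (Cau_map u < Cau_map v)%O = (u < v)%O.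
Proof. by rewrite !lt_neqAle Cau_map_le (inj_eq Cau_map_inj). Qed.

Lemma null_map u v : null (Cau_map u) (Cau_map v) <-> null u v.
Proof. by rewrite /null !Cau_point_map isoj. Qed.

Lemma Cau_map_preimage (w : Cau l X) : range j (tag w).1 -> range j (tag w).2 ->
  range j (Cau_point w) -> exists u, Cau_map u = w.
Proof.
move=> [a _ aw] [b _ bw] [y _ yw]; have [w1 w2 w3] := Cau_betweenP w.
have yP : (y, time w) \in Cau_between l a b.
  by apply/mem_set; split => //=; rewrite -isoj ?aw ?bw yw.
exists (existT (fun ab => set_type (Cau_between l ab.1 ab.2)) (a, b)
  (exist _ (y, time w) yP)).
apply: Cau_eq => //=; rewrite aw bw; by case: (tag w).
Qed.

Lemma order_complex_image s :
  order_complex (Cau l X) (fset_image Cau_map s) <-> order_complex (Cau l Y) s.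
Proof.
rewrite !order_complexP; split=> [[/fset0Pn[w /fset_imageP[u us _]] tot]|].
  split; first by apply/fset0Pn; exists u.
  move=> v v' vs v's; rewrite -!Cau_map_le.
  by apply: tot; rewrite mem_fset_image//; exact: Cau_map_inj.
move=> [/fset0Pn[u us] tot]; split.
  by apply/fset0Pn; exists (Cau_map u); rewrite mem_fset_image//; exact: Cau_map_inj.
move=> _ _ /fset_imageP[v vs ->] /fset_imageP[v' v's ->].
by rewrite !Cau_map_le; exact: tot.
Qed.

Lemma full_adjacent_image s :
  full_adjacent (fset_image Cau_map s) <-> full_adjacent s.
Proof.
have mem u : (Cau_map u \in fset_image Cau_map s) = (u \in s).
  by rewrite mem_fset_image//; exact: Cau_map_inj.
split=> -[[u0 us0 u00] [u1 us1 u1l] adj]; split.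
- by move: us0 u00 => /fset_imageP[u us ->] tu; exists u.
- by move: us1 u1l => /fset_imageP[u us ->] tu; exists u.
- move=> u v us vs uv; have := adj (Cau_map u) (Cau_map v).
  rewrite !mem Cau_map_lt => /(_ us vs uv)[/null_map|[_ /fset_imageP[w ws ->]]].
    by left.
  by rewrite !Cau_map_lt => uwv; right; exists w.
- by exists (Cau_map u0); rewrite ?mem.
- by exists (Cau_map u1); rewrite ?mem.
- move=> _ _ /fset_imageP[u us ->] /fset_imageP[v vs ->]; rewrite Cau_map_lt => uv.
  have [/null_map|[w ws uwv]] := adj u v us vs uv; first by left.
  by right; exists (Cau_map w); rewrite ?mem// !Cau_map_lt.
Qed.

Lemma short_complex_image s : 0 <= l ->
  short_complex (fset_image Cau_map s) <-> short_complex s.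
Proof.
move=> l0; rewrite !short_complexP// order_complex_image.
by split=> -[? nf]; split => // /full_adjacent_image.
Qed.

(** Fullness supplies the end points: the vertices at times 0 and [l] lie over the two components of
    the tag, which are therefore in the range of [j] as well. *)
Lemma full_image (t : {fset Cau l X}) : order_complex (Cau l X) t ->
  full_adjacent t -> (forall w, w \in t -> range j (Cau_point w)) ->
  exists s, t = fset_image Cau_map s.
Proof.
move=> /order_complexP[_ tot] [[u0 us0 u00] [u1 us1 u1l] _] tj.
apply: (fset_image_exists Cau_map_inj) => w wt.
have tagE (u v : Cau l X) : u \in t -> v \in t -> tag u = tag v.
  move=> ut vt; have /orP[/Cau_tag//|/Cau_tag] := tot u v ut vt.
  exact: esym.
apply: Cau_map_preimage; last exact: tj.
  rewrite (tagE w u0)//; have [_ + _] := Cau_betweenP u0.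
  rewrite u00 => le0; rewrite (_ : (tag u0).1 = Cau_point u0); first exact: tj.
  by apply: mdist_positivity; apply/eqP; rewrite eq_le le0 mdist_ge0.
rewrite (tagE w u1)//; have [_ _] := Cau_betweenP u1.
rewrite u1l subrr => le0.
rewrite (_ : (tag u1).2 = Cau_point u1); first exact: tj.
by apply/esym/mdist_positivity; apply/eqP; rewrite eq_le le0 mdist_ge0.
Qed.

End isometric_embedding.

(** * The two maps of the homotopy equivalence *)

Section wedge_decomposition.
Context (R : realType) (X G H : metricType R) (jG : G -> X) (jH : H -> X).
Context (A : set H) (l : R).
Hypotheses (isoG : isometric jG) (isoH : isometric jH).
Hypothesis cover : forall x, range jG x \/ range jH x.
Hypothesis overlap : forall h, A h <-> range jG (jH h).
Hypothesis projX : forall y, ~ range jG y -> exists q,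
  [/\ range jG q, range jH q &
      forall x, range jG x -> mdist x y = mdist x q + mdist q y].
Hypothesis (l0 : 0 <= l).

Local Notation CX := (Cau l X).
Local Notation pt := (@Cau_point R l X).
Local Notation JG := (Cau_map isoG).
Local Notation JH := (Cau_map isoH).
Local Notation KX := (order_complex CX).
Local Notation KG := (order_complex (Cau l G)).
Local Notation KH := (@interior_simplices R l H A `|` @short_complex R l H).
Local Notation SX := (@short_complex R l X).
Local Notation SG := (@short_complex R l G).
Local Notation SH := (@short_complex R l H).
Local Notation MX := (magnitude_type l X).
Local Notation MG := (magnitude_type l G).
Local Notation MH := (interior_magnitude_type l A).
Local Notation summand b := (if b then MH else MG).
Local Notation wedge_in b := (@wedge_lift bool (fun i : bool => summand i)
  (fun i => @point (summand i)) b).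
Local Notation offGX := (@offG R X l (range jG)).
Local Notation offHX := (@offH R X l (range jH)).

Implicit Types (t : {fset CX}) (y : CX -> R).

Let JGinj := @Cau_map_inj R l G X jG isoG.
Let JHinj := @Cau_map_inj R l H X jH isoH.

Lemma short_subset_closed (Y : metricType R) :
  subset_closed (@short_complex R l Y).
Proof. by move=> s s'; exact: short_complexS. Qed.

Lemma KH_order_complex s : KH s -> order_complex (Cau l H) s.
Proof. by move=> [[c [cc _] <-]|[c [cc _] <-]]; exists c. Qed.

(** Otherwise [z] would lie between a null pair [u], [v] of [s]. Both distances to [pt z] pass
    through its projection [q], so the detour from [q] to [pt z] and back has length zero, and
    [pt z] would be in the range of [jG]. *)
Lemma not_full_off s t z : KX t -> (s `<=` t)%fset -> s != fset0 ->
  (forall w, w \in s -> ~~ offGX w) -> z \in t -> offGX z ->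
  ~ full_adjacent s.
Proof.
move=> Kt st s0 sG zt /asboolP oz fs.
have Ks := order_complexS Kt st s0.
have /order_complexP[_ tot] := Kt.
have [|u [v [us vs uz zv n]]] :=
    full_between (z := z) (full_adjacent_cover Ks fs).
  by move=> u us; apply: tot => //; exact: (fsubsetP st).
have inG w : w \in s -> range jG (pt w).
  by move=> /sG /asboolPn; exact: contrapT.
have [nuz nzv] := null_trans uz zv n.
have [q [Gq Hq dq]] := projX oz.
have du := dq _ (inG u us); have dv := dq _ (inG v vs).
have tri := metric_triangle (pt u) q (pt v).
have q0 := mdist_ge0 q (pt z).
move: n nuz nzv; rewrite /null (metric_sym (pt z)) => n nuz nzv.
rewrite (metric_sym q (pt v)) in tri.
apply: oz; rewrite -(_ : q = pt z)//; apply: mdist_positivity; lra.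
Qed.

(** The branch depends on the support and may change inside a simplex. On an unmixed simplex this
    happens only at points of short faces, where both branches give the base point. *)
Definition to_wedge (y : CX -> R) : wedge2 MH MG :=
  if `[< exists2 w, offGX w & y w != 0 >]
  then wedge_in true (bary_class KH SH (y \o JH))
  else wedge_in false (bary_class KG SG (y \o JG)).

Lemma wedge_in_point b : wedge_in b point = point :> wedge2 MH MG.
Proof.
exact: (@wedge_liftE bool (fun i : bool => summand i)
  (fun i => @point (summand i)) point point b point).
Qed.

Lemma pullH_short s y : SX s -> closed_simplex s y ->
  bary_class KH SH (y \o JH) = None.
Proof.
apply: (pullback_class_sub JHinj); first exact: short_subset_closed.
by move=> s' _ /(short_complex_image isoH _ l0).
Qed.

Lemma pullG_short s y : SX s -> closed_simplex s y ->
  bary_class KG SG (y \o JG) = None.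
Proof.
apply: (pullback_class_sub JGinj); first exact: short_subset_closed.
by move=> s' _ /(short_complex_image isoG _ l0).
Qed.

Lemma to_wedge_short s y : SX s -> closed_simplex s y -> to_wedge y = point.
Proof.
move=> Ss sy; rewrite /to_wedge; case: ifP => _.
  by rewrite (pullH_short Ss sy) wedge_in_point.
by rewrite (pullG_short Ss sy) wedge_in_point.
Qed.

Lemma to_wedge_G t y : closed_simplex t y ->
  (forall w, w \in t -> ~~ offGX w) ->
  to_wedge y = wedge_in false (bary_class KG SG (y \o JG)).
Proof.
move=> [_ ty _] tG; rewrite /to_wedge; case: asboolP => // -[w ow yw].
have [/tG|/ty y0] := boolP (w \in t); first by rewrite ow.
by rewrite y0 eqxx in yw.
Qed.

(** Where the vertices off [G] have mass zero, [not_full_off] makes the support short, so the other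
    branch agrees. *)
Lemma to_wedge_H t y z : KX t -> closed_simplex t y -> z \in t -> offGX z ->
  to_wedge y = wedge_in true (bary_class KH SH (y \o JH)).
Proof.
move=> Kt ty zt oz; rewrite /to_wedge; case: asboolP => // noff.
have [s [st s0 sy sE]] := closed_simplex_support ty.
have sS : SX s.
  apply/short_complexP => //; split; first exact: order_complexS Kt st s0.
  apply: (not_full_off Kt st s0 _ zt oz) => w; rewrite sE => yw.
  by apply/negP => ow; apply: noff; exists w.
by rewrite (pullG_short sS sy) (pullH_short sS sy) !wedge_in_point.
Qed.

Context (q0 : CX).
Local Notation ins := (insertion (range jG) (range jH) q0).
Local Notation unmixed := (unmixed_subcomplex offHX offGX KX).

Let Kp := order_complex_insertion_closed cover projX q0.
Let Sp := short_complex_insertion_closed cover projX q0 l0.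

Variant unmixed_spec (t : {fset CX}) : Prop :=
| UnmixedShort of SX t
| UnmixedG s of KG s & t = fset_image JG s & (forall w, w \in t -> ~~ offGX w)
| UnmixedH s z of KH s & t = fset_image JH s & z \in t & offGX z.

Lemma unmixedP t : unmixed t -> unmixed_spec t.
Proof.
move=> [Kt mix]; have [St|nSt] := pselect (SX t); first exact: UnmixedShort.
have full : full_adjacent t.
  by apply: contrapT => nf; apply: nSt; apply/short_complexP.
have [[z [zt oz]]|noff] := pselect (exists z, z \in t /\ offGX z); last first.
  have tG w : w \in t -> ~~ offGX w.
    by move=> wt; apply/negP => ow; apply: noff; exists w.
  have [|s ts] := full_image isoG Kt full.
    by move=> w /tG /asboolPn; exact: contrapT.
  apply: (UnmixedG _ ts) => //.
  by apply/(order_complex_image isoG); rewrite -ts.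
have [|s ts] := full_image isoH Kt full.
  move=> w wt; apply: contrapT => nw; move/negP: mix; apply.
  have ow : offHX w by apply/asboolP.
  apply/andP; split; apply/hasP; [exists w|exists z] => //.
    by rewrite !inE wt /= /outer ow.
  by rewrite !inE zt /= /outer oz orbT.
apply: (UnmixedH _ ts zt oz); left.
have Ks : order_complex (Cau l H) s.
  by apply/(order_complex_image isoH); rewrite -ts.
have [c cc cs] := Ks; exists c => //; split => //.
move: zt; rewrite ts => /fset_imageP[u us zu]; exists u.
  by move: us; rewrite -cs inE.
by move=> Au; move/asboolP: oz; apply; rewrite zu; apply/overlap.
Qed.

Lemma to_wedge_continuous :
  continuous (fun y : realization R unmixed => to_wedge (val y)).
Proof.
apply: continuous_from_realization => t Lt; have [Kt _] := Lt.
case: (unmixedP Lt) => [St|s Ks ts tG|s z Ks ts zt oz].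
- rewrite (_ : _ \o _ = fun=> point); first exact: cst_continuous.
  by apply/funext => y /=; exact: to_wedge_short St (simplexP y).
- rewrite (_ : _ \o _ = (wedge_in false) \o
      (fun y : simplex R t => bary_class KG SG (val y \o JG))).
    move=> y; apply: continuous_comp; last exact: wedge_lift_continuous.
    by move: y; rewrite ts; exact: pullback_class_continuous.
  by apply/funext => y /=; exact: to_wedge_G (simplexP y) tG.
- rewrite (_ : _ \o _ = (wedge_in true) \o
      (fun y : simplex R t => bary_class KH SH (val y \o JH))).
    move=> y; apply: continuous_comp; last exact: wedge_lift_continuous.
    by move: y; rewrite ts; exact: pullback_class_continuous.
  by apply/funext => y /=; exact: to_wedge_H Kt (simplexP y) zt oz.
Qed.

Definition wedge_of_gluing : MX -> wedge2 MH MG :=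
  collapse_lift point
    (fun x : realization R KX => to_wedge (val (retract Kp x))).

Lemma to_wedge_retract_short (x : realization R KX) : subrealization SX x ->
  to_wedge (val (retract Kp x)) = point.
Proof.
move=> /(deform_sub Kp Sp 1)[s Ss sx].
exact: to_wedge_short Ss sx.
Qed.

Lemma wedge_of_gluing_continuous : continuous wedge_of_gluing.
Proof.
apply: collapse_lift_continuous; first exact: to_wedge_retract_short.
move=> x; apply: (@continuous_comp _ _ _ (retract Kp)
  (fun y : realization R unmixed => to_wedge (val y))).
  exact: retract_continuous.
exact: to_wedge_continuous.
Qed.

Definition gluing_of_G : MG -> MX := collapse_lift None
  (fun y : realization R KG => bary_class KX SX (pushforward JG (val y))).

Definition gluing_of_H : MH -> MX := collapse_lift None
  (fun y : realization R KH => bary_class KX SX (pushforward JH (val y))).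

Definition gluing_of_summand (b : bool) : summand b -> MX :=
  match b with true => gluing_of_H | false => gluing_of_G end.

Definition gluing_of_wedge : wedge2 MH MG -> MX := wedge_fun gluing_of_summand.

Lemma pushG_short (y : realization R KG) : subrealization SG y ->
  bary_class KX SX (pushforward JG (val y)) = None.
Proof.
move=> [s Ss sy]; apply: (@bary_class_sub _ _ _ _ (fset_image JG s)).
  exact/(short_complex_image isoG).
exact: closed_simplex_pushforward.
Qed.

Lemma pushH_short (y : realization R KH) : subrealization SH y ->
  bary_class KX SX (pushforward JH (val y)) = None.
Proof.
move=> [s Ss sy]; apply: (@bary_class_sub _ _ _ _ (fset_image JH s)).
  exact/(short_complex_image isoH).
exact: closed_simplex_pushforward.
Qed.

Lemma gluing_of_wedgeE b (q : summand b) :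
  gluing_of_wedge (wedge_in b q) = gluing_of_summand q.
Proof.
rewrite /gluing_of_wedge.
apply: (@wedge_lift_funE bool (fun b : bool => summand b)
  (fun i => @point (summand i)) _ gluing_of_summand b q).
by move=> [] [].
Qed.

Lemma gluing_of_wedge_continuous : continuous gluing_of_wedge.
Proof.
apply: wedge_fun_continuous; last by move=> [] [].
case; apply: collapse_lift_continuous.
- exact: pushH_short.
- apply: (pushforward_class_continuous JHinj) => s /KH_order_complex.
  by move=> /(order_complex_image isoH).
- exact: pushG_short.
- apply: (pushforward_class_continuous JGinj) => s.
  by move=> /(order_complex_image isoG).
Qed.

Lemma gluing_of_to_wedge (x : realization R unmixed) :
  gluing_of_wedge (to_wedge (val x)) = bary_class KX SX (val x).
Proof.
have [t0 Lt0 t0x] := realizationP x.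
have [t [tt0 tn0 tx tE]] := closed_simplex_support t0x.
have Kt : KX t := order_complexS Lt0.1 tt0 tn0.
have Lt : unmixed t.
  split=> //; apply: contra Lt0.2; apply: mixedS; exact: outer_partS.
case: (unmixedP Lt) => [St|s Ks ts tG|s z Ks ts zt oz].
- rewrite (to_wedge_short St tx) (bary_class_sub _ St tx).
  by rewrite -(wedge_in_point true) gluing_of_wedgeE.
- rewrite (to_wedge_G tx tG) gluing_of_wedgeE /= /gluing_of_G.
  have sx : closed_simplex s (val x \o JG).
    by apply: (closed_simplex_pullback JGinj); rewrite -ts.
  rewrite (bary_classE _ Ks sx) (collapse_lift_map pushG_short).
  rewrite /= pullbackK// => w xw; move: (tE w).
  by rewrite xw ts => /fset_imageP[u _ ->]; exists u.
- rewrite (to_wedge_H Kt tx zt oz) gluing_of_wedgeE /= /gluing_of_H.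
  have sx : closed_simplex s (val x \o JH).
    by apply: (closed_simplex_pullback JHinj); rewrite -ts.
  rewrite (bary_classE _ Ks sx) (collapse_lift_map pushH_short).
  rewrite /= pullbackK// => w xw; move: (tE w).
  by rewrite xw ts => /fset_imageP[u _ ->]; exists u.
Qed.

Lemma gluing_of_wedge_of_gluing q :
  gluing_of_wedge (wedge_of_gluing q) = deform_collapse Kp (1, q).
Proof.
have [->|[x nx ->]] := collapse_case q.
  rewrite [wedge_of_gluing _]/= -[X in gluing_of_wedge X](wedge_in_point true).
  by rewrite gluing_of_wedgeE.
rewrite (deform_collapse_map Kp Sp) /wedge_of_gluing.
rewrite (collapse_lift_map to_wedge_retract_short).
by rewrite gluing_of_to_wedge -bary_class_val.
Qed.

Lemma wedge_of_unmixed s x : KX s -> closed_simplex s x ->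
  ~~ mixed offHX offGX s ->
  wedge_of_gluing (bary_class KX SX x) = to_wedge x.
Proof.
move=> Ks sx mix; rewrite (bary_classE _ Ks sx) /wedge_of_gluing.
rewrite (collapse_lift_map to_wedge_retract_short).
congr to_wedge; rewrite [LHS](val_deform Kp 1 (s := s)) //=.
apply: push_id => M mM.
have [[w wM xw]|no] := pselect (exists2 w, w \in M & x w = 0).
  by exists w.
exfalso; move/negP: mix; apply; apply: mixedS mM; apply/fsubsetP => w wM.
by apply: contraT => ws; exfalso; apply: no; exists w => //; have [_ ->] := sx.
Qed.

(** Simplices coming from [G] or [H] are unmixed, so the retraction fixes their points. It remains
    to see that a point of the [H] summand other than the base point has a vertex off [G] in its
    support. *)
Lemma wedge_of_gluing_of_wedge z : wedge_of_gluing (gluing_of_wedge z) = z.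
Proof.
have [b [q ->]] : exists b (q : summand b), z = wedge_in b q.
  exists (projT1 (repr z)), (projT2 (repr z)).
  by rewrite /wedge_lift /= -[LHS]reprK; case: (repr z).
rewrite gluing_of_wedgeE; case: b q => q; rewrite /= /gluing_of_H /gluing_of_G.
  have [->|[y ny ->]] := collapse_case q; first by rewrite /= wedge_in_point.
  rewrite (collapse_lift_map pushH_short).
  have [s Ks sy] := realizationP y.
  have [s' [s's s'0 s'y s'E]] := closed_simplex_support sy.
  have Ks1 := KH_order_complex Ks.
  have Ks' : order_complex (Cau l H) s' := order_complexS Ks1 s's s'0.
  have KX' : KX (fset_image JH s') by apply/(order_complex_image isoH).
  have pX := closed_simplex_pushforward JHinj s'y.
  rewrite (wedge_of_unmixed KX' pX); last first.
    apply/negP => /andP[/hasP[_ /fset_imageP[u _ ->] /asboolP]] + _.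
    by apply; exists (Cau_point u).
  have [[w ws ow]|noff] := pselect (exists2 w, w \in fset_image JH s' & offGX w).
    by rewrite (to_wedge_H KX' pX ws ow) pushforwardK// bary_class_val.
  (* The carrier [s] is short or has the interior vertex [u]; in the latter case [not_full_off],
     applied with [u], makes the support [s'] short. *)
  exfalso; apply: ny.
  case: Ks => [|Ss]; last by exists s.
  move=> [c [cc [u uc nAu]] cs]; exists s' => //.
  apply/short_complexP => //; split=> //.
  move=> /(full_adjacent_image isoH).
  apply: (@not_full_off (fset_image JH s') (fset_image JH s) (JH u)).
  - by apply/(order_complex_image isoH).
  - apply/fsubsetP => _ /fset_imageP[v vs' ->].
    by rewrite mem_fset_image// (fsubsetP s's).
  - have /fset0Pn[v vs'] := s'0; apply/fset0Pn; exists (JH v).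
    by rewrite mem_fset_image.
  - by move=> w ws; apply/negP => ow; apply: noff; exists w.
  - by rewrite mem_fset_image// -cs inE.
  - by apply/asboolP => /overlap.
have [->|[y ny ->]] := collapse_case q; first by rewrite /= wedge_in_point.
rewrite (collapse_lift_map pushG_short).
have [s Ks sy] := realizationP y.
have KX' : KX (fset_image JG s) by apply/(order_complex_image isoG).
have pX := closed_simplex_pushforward JGinj sy.
have sG w : w \in fset_image JG s -> ~~ offGX w.
  move=> /fset_imageP[u _ ->]; apply/negP => /asboolP; apply.
  by exists (Cau_point u).
rewrite (wedge_of_unmixed KX' pX); last first.
  by apply/negP => /andP[_ /hasP[w /sG/negP]].
by rewrite (to_wedge_G pX sG) pushforwardK// bary_class_val.
Qed.

Lemma magnitude_type_wedge :
  pointed_homotopy_equivalent R MX (wedge2 MH MG).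
Proof.
exists wedge_of_gluing, gluing_of_wedge; split; [split|split].
- exact: wedge_of_gluing_continuous.
- exact: gluing_of_wedge_continuous.
- by [].
- by rewrite -(wedge_in_point true) gluing_of_wedgeE.
(* Time is reversed, since the homotopy has to end at the identity, where the deformation starts. *)
- exists (fun z : R * MX => deform_collapse Kp (1 - z.1, z.2)); split.
  + apply: continuous_subspaceT => z.
    apply: (@continuous_comp _ _ _ (fun z : R * MX => (1 - z.1, z.2))
      (deform_collapse Kp)); last exact: deform_collapse_continuous.
    have c1 : continuous (fun z : R * MX => 1 - z.1).
      by move=> z'; apply: cvgB; [exact: cvg_cst|exact: cvg_fst].
    have c2 : continuous (fun z : R * MX => z.2) by move=> z'; exact: cvg_snd.
    exact: (cvg_pair (c1 z) (c2 z)).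
  + by move=> q; rewrite /= subr0 gluing_of_wedge_of_gluing.
  + by move=> q; rewrite /= subrr deform_collapse0.
  + by [].
- exists snd; split=> //.
  + by apply: continuous_subspaceT => z; exact: cvg_snd.
  + by move=> z /=; rewrite wedge_of_gluing_of_wedge.
Qed.

End wedge_decomposition.

Theorem theorem5p14 (R : realType) (K G H : metricType R)
    (K0 : [set: K] !=set0) (cK : compact [set: K])
    (iG : K -> G) (iH : K -> H) (isoG : isometric iG) (isoH : isometric iH)
    (projH : forall y : H, ~ range iH y -> projects_to (range iH) y)
    (l : R) (l_ge0 : 0 <= l) :
  pointed_homotopy_equivalent R
    (magnitude_type l (gluing K0 cK isoG isoH))
    (wedge2 (interior_magnitude_type l (range iH)) (magnitude_type l G)).
Proof.
pose X := gluing K0 cK isoG isoH.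
pose pi_ : G + H -> X := \pi_X%qT.
have distE u v : mdist (pi_ u) (pi_ v) = glue_dist iG iH u v.
  exact: gluing_mdistE.
have piE k : pi_ (inl (iG k)) = pi_ (inr (iH k)).
  apply: mdist_positivity; rewrite distE.
  by apply/(glue_dist_eq0 K0 cK isoG isoH) => /=; apply/asboolP; exists k.
have pi_surj x : exists u, pi_ u = x by exists (repr x); exact: reprK.
pose jG g := pi_ (inl g); pose jH h := pi_ (inr h).
have isojG : isometric jG by move=> g g'; rewrite distE.
have isojH : isometric jH by move=> h h'; rewrite distE.
have overlap h : range iH h <-> range jG (jH h).
  split=> [[k _ <-]|[g _ gh]]; first by exists (iG k) => //; exact: piE.
  have : mdist (jG g) (jH h) = 0 by rewrite gh mdistxx.
  rewrite distE => /(glue_dist_eq0 K0 cK isoG isoH)/asboolP[k [_ hk]].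
  by exists k.
have cover x : range jG x \/ range jH x.
  by have [[g|h] <-] := pi_surj x; [left; exists g|right; exists h].
have projX y : ~ range jG y -> exists q, [/\ range jG q, range jH q &
    forall x, range jG x -> mdist x y = mdist x q + mdist q y].
  move=> ny; have [y' Ey] := pi_surj y; case: y' Ey => [g gy|h hy].
    by exfalso; apply: ny; exists g.
  have nh : ~ range iH h by move=> /overlap; rewrite /jH hy.
  have [_ [k _ <-] kh] := projH h nh.
  exists (jH (iH k)); split; [|by exists (iH k)|].
    by exists (iG k) => //; exact: piE.
  move=> _ [g _ <-]; rewrite -hy -/(jH h) isojH -[jH (iH k)]piE isojG distE /=.
  (* The projection to [K] serves all of [G]: the route through a minimizing [k1] passes on to [h]
     through [k], so [k] is a minimizer too. *)
  have [k1 [E kmin]] := glue_cross_min K0 cK isoG isoH g h.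
  apply/eqP; rewrite eq_le kmin /= E (kh (iH k1)); last by exists k1.
  have := metric_triangle g (iG k1) (iG k); rewrite isoG isoH; lra.
(* A point of [K], with both end points equal to it and time 0, provides the default event for
   [insertion]. *)
have [k _] := K0.
have x0P : (jG (iG k), 0) \in Cau_between l (jG (iG k)) (jG (iG k)).
  by apply/mem_set; split; rewrite /= ?mdistxx ?subr0 ?lexx.
pose q0 : Cau l X := existT (fun ab => set_type (Cau_between l ab.1 ab.2))
  (jG (iG k), jG (iG k)) (exist _ (jG (iG k), 0) x0P).
exact: (magnitude_type_wedge isojG isojH cover overlap projX l_ge0 q0).
Qed.
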